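(* Let $E=\{k^4:k\ge1\}$ be the sequence of biquadrates and $1\le p<\infty$. If $L^p_E(\mathbb{T})$ has real umap, then $p=2$ or $p=4$.
   Context: $\mathbb{T}=\{z\in\mathbb{C}:|z|=1\}$ with normalized Haar measure $m$; $L^p_E(\mathbb{T})$ is the space of complex-valued $f\in L^p(\mathbb{T})$ with $\widehat f(n)=\int f(z)z^{-n}\,dm(z)=0$ for all $n\notin E$. A separable Banach space $Y$ has real umap (metric unconditional approximation property) if for every $\varepsilon>0$ there is a sequence $\{T_k\}_{k\ge1}$ of bounded finite-rank operators on $Y$ with $T_ky\to y$ for all $y\in Y$ such that, with $T_0=0$, $\|\sum_{k=1}^n\epsilon_k(T_k-T_{k-1})\|\le1+\varepsilon$ for all $n$ and all $\epsilon_k\in\{-1,1\}$. *)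

(* Defs.v *)
From HB Require Import structures.
From mathcomp Require Import all_boot all_order all_algebra complex.
From mathcomp Require Import all_classical all_reals all_analysis.
From mathcomp Require Import measurable_realfun.

Set Implicit Arguments.
Unset Strict Implicit.
Unset Printing Implicit Defensive.

Import Order.TTheory GRing.Theory Num.Theory Normc.
Import numFieldNormedType.Exports.

Local Open Scope classical_set_scope.
Local Open Scope complex_scope.
Local Open Scope ring_scope.

Section complex_measurable.
Variable R : realType.

(* The Borel sigma-algebra of R[i] is transported from that of R * R; a function
   is measurable iff its real and imaginary parts are (measurable_complexP). *)
Definition reim (z : R[i]) : R * R := (complex.Re z, complex.Im z).

HB.instance Definition _ := isPointed.Build R[i] 0.
HB.instance Definition _ :=
  Measurable.copy R[i] (g_sigma_algebra_preimageType reim).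
End complex_measurable.

Lemma measurable_reim (R : realType) : measurable_fun [set: R[i]] (@reim R).
Proof. by move=> _ B mB; exists B. Qed.

Lemma measurable_complexP d (T : measurableType d) (R : realType) (f : T -> R[i]) :
  measurable_fun setT f <->
  measurable_fun setT (fun x => complex.Re (f x)) /\
  measurable_fun setT (fun x => complex.Im (f x)).
Proof.
split => [mf|[mr mi]].
  have := measurableT_comp (@measurable_reim R) mf.
  by move=> /measurable_fun_pairP.
move=> _ _ [B mB <-]; rewrite !setTI.
have /(_ measurableT B mB) := measurable_fun_pair mr mi.
by rewrite setTI.
Qed.

Section circle.
Variable R : realType.

Record circle := Circle {circle_val :> R[i]; _ : `|circle_val| == 1}.
HB.instance Definition _ := [isSub for circle_val].
HB.instance Definition _ := [Choice of circle by <:].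

Lemma expi_subproof (t : R) : `|cos t +i* sin t| == 1 :> R[i].
Proof. by rewrite normc_def/= cos2Dsin2 sqrtr1. Qed.
Definition expi (t : R) : circle := Circle (expi_subproof t).

HB.instance Definition _ := isPointed.Build circle (expi 0).
HB.instance Definition _ :=
  Measurable.copy circle (g_sigma_algebra_preimageType circle_val).

Lemma measurable_circle_val : measurable_fun [set: circle] circle_val.
Proof. by move=> _ B mB; exists B. Qed.

Lemma measurable_expi : measurable_fun [set: R] expi.
Proof.
move=> _ _ [B mB <-]; rewrite !setTI.
suff /(_ measurableT B mB) : measurable_fun [set: R] (circle_val \o expi).
  by rewrite setTI.
apply/measurable_complexP; split => /=; apply: continuous_measurable_fun.
  exact: continuous_cos.
exact: continuous_sin.
Qed.

Definition turn (t : R) : circle := expi (2 * pi * t).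
Lemma measurable_turn : measurable_fun [set: R] turn.
Proof.
apply: (measurableT_comp measurable_expi).
exact: measurable_funM.
Qed.

(* Normalized Haar measure of the circle: the image of the Lebesgue measure of
   [0, 1] under t |-> exp(2 i pi t). *)
Definition haar : set circle -> \bar R :=
  pushforward (mrestr lebesgue_measure (measurable_itv `[0, 1])) turn.

Let haar0 : haar set0 = 0%E.
Proof. by have mt := measurable_turn; exact: measure0. Qed.

Let haar_ge0 A : (0 <= haar A)%E.
Proof. by have mt := measurable_turn; exact: measure_ge0. Qed.

Let haar_sigma_additive : semi_sigma_additive haar.
Proof. by have mt := measurable_turn; exact: measure_semi_sigma_additive. Qed.

HB.instance Definition _ :=
  isMeasure.Build _ _ _ haar haar0 haar_ge0 haar_sigma_additive.

Lemma haar_setT : haar [set: circle] = 1%E.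
Proof.
rewrite /haar /pushforward preimage_setT /mrestr setTI.
by rewrite lebesgue_measure_itv/= lte_fin ltr01 EFinN sube0.
Qed.
HB.instance Definition _ := Measure_isProbability.Build _ _ _ haar haar_setT.
End circle.

Section Re_Im_normc.
Variable R : realType.
Implicit Types z w : R[i].
Lemma normCE z : `|z| = (normc z)%:C. Proof. by case: z. Qed.
Lemma normc_ge0 z : 0 <= normc z. Proof. by case: z => a b /=; exact: sqrtr_ge0. Qed.
Lemma cReD z w : complex.Re (z + w) = complex.Re z + complex.Re w.
Proof. by case: z; case: w. Qed.
Lemma cImD z w : complex.Im (z + w) = complex.Im z + complex.Im w.
Proof. by case: z; case: w. Qed.
Lemma cReM z w : complex.Re (z * w) =
  complex.Re z * complex.Re w - complex.Im z * complex.Im w.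
Proof. by case: z; case: w. Qed.
Lemma cImM z w : complex.Im (z * w) =
  complex.Re z * complex.Im w + complex.Im z * complex.Re w.
Proof. by case: z; case: w. Qed.
Lemma normr_Re_le z : `|complex.Re z| <= normc z.
Proof. by rewrite -lecR -normCE; exact: normc_ge_Re. Qed.
Lemma normr_Im_le z : `|complex.Im z| <= normc z.
Proof.
case: z => a b /=; rewrite -sqrtr_sqr ler_sqrt ?addr_ge0 ?sqr_ge0//.
by rewrite lerDr sqr_ge0.
Qed.
End Re_Im_normc.

Section complex_measurable_theory.
Context d (T : measurableType d) (R : realType).
Implicit Types f g : T -> R[i].

Lemma measurable_complexD f g : measurable_fun setT f ->
  measurable_fun setT g -> measurable_fun setT (f \+ g).
Proof.
move=> /measurable_complexP[rf imf] /measurable_complexP[rg img].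
apply/measurable_complexP; split => /=.
  under eq_fun do rewrite cReD; exact: measurable_funD.
under eq_fun do rewrite cImD; exact: measurable_funD.
Qed.

Lemma measurable_complexM f g : measurable_fun setT f ->
  measurable_fun setT g -> measurable_fun setT (f \* g).
Proof.
move=> /measurable_complexP[rf imf] /measurable_complexP[rg img].
apply/measurable_complexP; split => /=.
  under eq_fun do rewrite cReM.
  by apply: measurable_funB; exact: measurable_funM.
under eq_fun do rewrite cImM.
by apply: measurable_funD; exact: measurable_funM.
Qed.

Lemma measurable_normc f : measurable_fun setT f ->
  measurable_fun setT (fun x => normc (f x)).
Proof.
move=> /measurable_complexP[rf imf].
rewrite (_ : (fun _ => _) =
  (fun x => (complex.Re (f x) ^+ 2 + complex.Im (f x) ^+ 2) `^ 2^-1)); last first.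
  by apply/funext => x; rewrite powR12_sqrt ?addr_ge0 ?sqr_ge0//; case: (f x).
apply: (measurableT_comp (measurable_powR _)).
by apply: measurable_funD; exact: measurable_funX.
Qed.

End complex_measurable_theory.

Section cLfun.
Context d (T : measurableType d) (R : realType).
Variables (mu : {measure set T -> \bar R}) (p : R).
Implicit Types f g : T -> R[i].

(* normc is the R-valued modulus of R[i]; the norm `|z| of R[i] is R[i]-valued. *)
Definition cLnorm f : \bar R := 'N[mu]_p%:E[EFin \o (fun x => normc (f x))].

Definition cLfun : {pred T -> R[i]} :=
  mem [set f | measurable_fun setT f /\ (cLnorm f < +oo)%E].

Lemma cLfunE f : f \in cLfun <-> measurable_fun setT f /\ (cLnorm f < +oo)%E.
Proof. by split; rewrite inE. Qed.

Hypothesis p1 : 1 <= p.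
Let p1E : (1 <= p%:E)%E. Proof. by rewrite lee_fin. Qed.
Let p0 : 0 < p. Proof. exact: lt_le_trans p1. Qed.

Lemma le_Lnorm_EFin (u v : T -> R) : measurable_fun setT u ->
  measurable_fun setT v -> (forall x, `|u x| <= `|v x|) ->
  ('N[mu]_p%:E[EFin \o u] <= 'N[mu]_p%:E[EFin \o v])%E.
Proof.
move=> mu_ mv uv; rewrite unlock.
have mabs (w : T -> R) : measurable_fun setT w ->
    measurable_fun setT (fun x => (`|(EFin \o w) x| `^ p)%E).
  move=> mw; apply/measurable_EFinP.
  apply: (measurableT_comp (measurable_powR _)).
  exact: measurableT_comp.
have ip : 0 <= p^-1 by rewrite invr_ge0 ltW.
apply: (gt0_ler_poweR ip); rewrite ?in_itv/= ?leey ?andbT ?integral_ge0//.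
apply: ge0_le_integral => //.
- exact: mabs.
- exact: mabs.
- move=> x _; rewrite lee_fin /=; apply: ge0_ler_powR; rewrite ?nnegrE//.
  exact: ltW.
Qed.

Lemma cLnorm_ge0 f : (0 <= cLnorm f)%E. Proof. exact: Lnorm_ge0. Qed.

Lemma cLnorm_normcLfun f : f \in cLfun -> (fun x => normc (f x)) \in Lfun mu p%:E.
Proof.
move=> /cLfunE[mf ff]; rewrite inE; apply/andP; split; rewrite inE//=.
exact: measurable_normc.
Qed.

Lemma cLnormD f g : measurable_fun setT f -> measurable_fun setT g ->
  (cLnorm (f \+ g)%R <= cLnorm f + cLnorm g)%E.
Proof.
move=> mf mg.
have mnf := measurable_normc mf; have mng := measurable_normc mg.
apply: (le_trans _ (minkowski_EFin mu mnf mng p1)).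
apply: le_Lnorm_EFin => [||x].
- exact/measurable_normc/measurable_complexD.
- exact: measurable_funD.
- by rewrite /= !ger0_norm ?addr_ge0 ?normc_ge0//; exact: le_normcD.
Qed.

Lemma cLnormZ a f : f \in cLfun ->
  (cLnorm (a \*: f)%R = (normc a)%:E * cLnorm f)%E.
Proof.
move=> fL; have nL := cLnorm_normcLfun fL.
have := LnormZ (Lfun_Sub p1E nL) (normc a).
rewrite ger0_norm ?normc_ge0// => <-.
by rewrite /cLnorm; congr Lnorm; apply/funext => x /=; rewrite normcM.
Qed.

Lemma cLfun_submod_closed : submod_closed cLfun.
Proof.
split.
  apply/cLfunE; split; first exact: measurable_cst.
  rewrite /cLnorm (_ : _ \o _ = cst 0%E).
    by rewrite Lnorm0 ?ltry// eqe gt_eqF.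
  by apply/funext => x /=; rewrite expr0n addr0 sqrtr0.
move=> a f g fL gL.
move: (fL) (gL) => /cLfunE[mf ff] /cLfunE[mg fg].
have maf : measurable_fun setT (a \*: f : T -> R[i]).
  by apply: (measurable_complexM (f := cst a)) => //; exact: measurable_cst.
apply/cLfunE; split; first exact: measurable_complexD.
apply: (le_lt_trans (cLnormD maf mg)); rewrite cLnormZ//.
by rewrite lte_add_pinfty// lte_mul_pinfty// lee_fin normc_ge0.
Qed.

Lemma ae_eq_cLnorm f g : measurable_fun setT f -> measurable_fun setT g ->
  f = g %[ae mu] -> cLnorm f = cLnorm g.
Proof.
move=> mf mg fg; rewrite /cLnorm unlock; congr (_ `^ _)%E.
have mabs (w : T -> R[i]) : measurable_fun setT w ->
    measurable_fun setT (fun x => (`|(EFin \o (fun x => normc (w x))) x| `^ p)%E).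
  move=> mw; apply/measurable_EFinP.
  apply: (measurableT_comp (measurable_powR _)).
  by apply: measurableT_comp => //; exact: measurable_normc.
apply: ae_eq_integral => //; [exact: mabs|exact: mabs|].
by apply: filterS fg => x /[apply] /= ->.
Qed.

Lemma cLnorm_eq0 f : measurable_fun setT f -> cLnorm f = 0%E ->
  f = cst 0 %[ae mu].
Proof.
move=> mf /Lnorm_eq0_eq0.
have /[swap]/[apply] : measurable_fun setT (EFin \o (fun x => normc (f x))).
  exact/measurable_EFinP/measurable_normc.
rewrite lte_fin p0 => /(_ isT).
by apply: filterS => x /[apply] /= -[/eq0_normc].
Qed.

End cLfun.

Section cLfunType.
Context d (T : measurableType d) (R : realType).
Variables (mu : {measure set T -> \bar R}) (p : R) (p1 : 1 <= p).

(* The proof of 1 <= p is a phantom parameter: the module structure needs it. *)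
Record cLfunType (p1' : 1 <= p) := CLfun {
  cLfun_val :> T -> R[i];
  cLfun_valP : cLfun_val \in cLfun mu p }.

Local Notation ty := (cLfunType p1).

HB.instance Definition _ := [isSub of ty for @cLfun_val p1].
HB.instance Definition _ := [Choice of ty by <:].
HB.instance Definition _ := GRing.isSubmodClosed.Build _ _ (cLfun mu p)
  (cLfun_submod_closed mu p1).
HB.instance Definition _ := [SubChoice_isSubLmodule of ty by <:].

Implicit Types f g h : ty.

Definition cae_eq f g := `[< (f : T -> R[i]) = g %[ae mu] >].
Let cae_refl : reflexive cae_eq.
Proof. by move=> f; apply/asboolP/aeW. Qed.
Let cae_sym : symmetric cae_eq.
Proof.
by move=> f g; apply/idP/idP => /asboolP h; apply/asboolP/ae_eq_sym.
Qed.
Let cae_trans : transitive cae_eq.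
Proof.
by move=> f g h /asboolP gf /asboolP fh; apply/asboolP/(ae_eq_trans gf fh).
Qed.
Canonical cae_eq_equiv := EquivRel cae_eq cae_refl cae_sym cae_trans.

Local Open Scope quotient_scope.

(* The space L^p(mu; C) of complex-valued p-integrable functions modulo
   mu-almost-everywhere equality. *)
Definition cLspace : Type := {eq_quot cae_eq}.
HB.instance Definition _ := Choice.on cLspace.
HB.instance Definition _ := EqQuotient.on cLspace.
Implicit Types x y z : cLspace.

Definition cLclass f : cLspace := \pi_cLspace f.
Definition cLrepr x : ty := repr x.

Lemma cLreprK : cancel cLrepr cLclass. Proof. exact: reprK. Qed.

Lemma cLclass_eqP f g : cLclass f = cLclass g <-> (f : T -> R[i]) = g %[ae mu].
Proof.
split => [/eqP|fg]; first by rewrite /cLclass eqmodE => /asboolP.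
by apply/eqP; rewrite /cLclass eqmodE; exact/asboolP.
Qed.

Lemma cLclassK f : (cLrepr (cLclass f) : T -> R[i]) = f %[ae mu].
Proof. by apply/cLclass_eqP; rewrite cLreprK. Qed.

Definition cL0 := cLclass 0.
Definition cLopp x := cLclass (- cLrepr x).
Definition cLadd x y := cLclass (cLrepr x + cLrepr y).
Definition cLscale (a : R[i]) x := cLclass (a *: cLrepr x).

Lemma cLadd_class f g : cLadd (cLclass f) (cLclass g) = cLclass (f + g).
Proof.
apply/cLclass_eqP.
by apply: filterS2 (cLclassK f) (cLclassK g) => t /= h1 h2 _;
   rewrite !fctE h1 ?h2.
Qed.
Lemma cLopp_class f : cLopp (cLclass f) = cLclass (- f).
Proof.
by apply/cLclass_eqP; apply: filterS (cLclassK f) => t /= h1 _; rewrite !fctE h1.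
Qed.
Lemma cLscale_class a f : cLscale a (cLclass f) = cLclass (a *: f).
Proof.
by apply/cLclass_eqP; apply: filterS (cLclassK f) => t /= h1 _; rewrite !fctE h1.
Qed.

Lemma cLaddA : associative cLadd.
Proof.
move=> x y z; rewrite -(cLreprK x) -(cLreprK y) -(cLreprK z).
by rewrite !cLadd_class addrA.
Qed.
Lemma cLaddC : commutative cLadd.
Proof. by move=> x y; rewrite /cLadd addrC. Qed.
Lemma cLadd0 : left_id cL0 cLadd.
Proof. by move=> x; rewrite -(cLreprK x) cLadd_class add0r. Qed.
Lemma cLaddN : left_inverse cL0 cLopp cLadd.
Proof. by move=> x; rewrite -(cLreprK x) cLopp_class cLadd_class addNr. Qed.
HB.instance Definition _ :=
  GRing.isZmodule.Build cLspace cLaddA cLaddC cLadd0 cLaddN.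

Lemma cLscaleA a b x : cLscale a (cLscale b x) = cLscale (a * b) x.
Proof. by rewrite -(cLreprK x) !cLscale_class scalerA. Qed.
Lemma cLscale1 : left_id 1 cLscale.
Proof. by move=> x; rewrite -(cLreprK x) cLscale_class scale1r. Qed.
Lemma cLscaleDr : right_distributive cLscale +%R.
Proof.
move=> a x y; rewrite -(cLreprK x) -(cLreprK y) [_ + _]cLadd_class.
by rewrite !cLscale_class [RHS]cLadd_class scalerDr.
Qed.
Lemma cLscaleDl x : {morph cLscale^~ x : a b / a + b}.
Proof.
move=> a b /=; rewrite -(cLreprK x) !cLscale_class [RHS]cLadd_class.
by rewrite scalerDl.
Qed.
HB.instance Definition _ := GRing.Zmodule_isLmodule.Build R[i] cLspace
  cLscaleA cLscale1 cLscaleDr cLscaleDl.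

Lemma cLclass_linear : linear (cLclass : ty -> cLspace).
Proof.
by move=> a f g; rewrite [a *: cLclass f]cLscale_class [RHS]cLadd_class.
Qed.
HB.instance Definition _ :=
  GRing.isLinear.Build R[i] ty cLspace *:%R cLclass cLclass_linear.

(* The norm takes its values in the scalar field R[i], as required by
   normedModType. *)
Definition cLspace_norm x : R[i] := (fine (cLnorm mu p (cLrepr x)))%:C.

Let cLmeas f : measurable_fun setT f.
Proof. by have /cLfunE[] := cLfun_valP f. Qed.

Lemma cLnorm_fin_num f : cLnorm mu p f \is a fin_num.
Proof.
by rewrite ge0_fin_numE ?cLnorm_ge0//; have /cLfunE[] := cLfun_valP f.
Qed.

Lemma cLspace_normE f : cLspace_norm (cLclass f) = (fine (cLnorm mu p f))%:C.
Proof. by congr (fine _)%:C; apply: ae_eq_cLnorm => //; exact: cLclassK. Qed.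

Lemma cLspace_normD x y : cLspace_norm (x + y) <= cLspace_norm x + cLspace_norm y.
Proof.
rewrite -(cLreprK x) -(cLreprK y) -raddfD !cLspace_normE -rmorphD lecR.
by rewrite -lee_fin EFinD !fineK ?cLnorm_fin_num//;
  apply: (cLnormD _ p1); exact: cLmeas.
Qed.
Lemma cLspace_normZ (a : R[i]) x : cLspace_norm (a *: x) = `|a| * cLspace_norm x.
Proof.
rewrite -(cLreprK x) -linearZ !cLspace_normE normCE -rmorphM; congr (_ %:C).
by rewrite (cLnormZ p1 _ (cLfun_valP _)) fineM ?cLnorm_fin_num.
Qed.
Lemma cLspace_norm0_eq0 x : cLspace_norm x = 0 -> x = 0.
Proof.
move=> [/eqP]; rewrite fine_eq0 ?cLnorm_fin_num// => /eqP.
move=> /(cLnorm_eq0 p1 (cLmeas _)) x0.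
rewrite -(cLreprK x); exact/(cLclass_eqP _ 0).
Qed.

HB.instance Definition _ := Lmodule_isNormed.Build R[i] cLspace
  cLspace_normD cLspace_normZ cLspace_norm0_eq0.
End cLfunType.

Section cintegral.
Context d (T : measurableType d) (R : realType).
Variable mu : {measure set T -> \bar R}.
Implicit Types f g : T -> R[i].

Definition cintegral f : R[i] :=
  (\int[mu]_x complex.Re (f x)) +i* (\int[mu]_x complex.Im (f x)).

Definition cintegrable f :=
  mu.-integrable setT (EFin \o (fun x => complex.Re (f x))) /\
  mu.-integrable setT (EFin \o (fun x => complex.Im (f x))).

Lemma cintegralD f g : cintegrable f -> cintegrable g ->
  cintegral (f \+ g) = cintegral f + cintegral g.
Proof.
move=> [rf imf] [rg img]; rewrite /cintegral/=.
under eq_Rintegral do rewrite cReD.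
under [X in _ +i* X]eq_Rintegral do rewrite cImD.
by rewrite !RintegralD.
Qed.

Lemma cintegralZ a f : cintegrable f ->
  cintegral (fun x => a * f x) = a * cintegral f.
Proof.
case: a => a b [rf imf]; rewrite /cintegral/=.
have rZ (c : R) h : mu.-integrable setT (EFin \o h) ->
    mu.-integrable setT (EFin \o (fun x => c * h x)).
  by move=> ih; rewrite (_ : _ \o _ = fun x => (c%:E * (EFin \o h) x)%E)//;
     exact: integrableZl.
under eq_Rintegral do rewrite cReM/=.
under [X in _ +i* X]eq_Rintegral do rewrite cImM/=.
rewrite RintegralB//; [|exact: rZ|exact: rZ].
rewrite RintegralD//; [|exact: rZ|exact: rZ].
by rewrite !RintegralZl.
Qed.

Lemma ae_eq_cintegral f g : measurable_fun setT f -> measurable_fun setT g ->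
  f = g %[ae mu] -> cintegral f = cintegral g.
Proof.
move=> /measurable_complexP[rf imf] /measurable_complexP[rg img] fg.
rewrite /cintegral /Rintegral; congr (fine _ +i* fine _);
  apply: ae_eq_integral => //; try exact/measurable_EFinP.
  by apply: filterS fg => x /[apply] ->.
by apply: filterS fg => x /[apply] ->.
Qed.

End cintegral.

Section fourier.
Variable R : realType.
Local Notation m := (@haar R).
Implicit Types (f : circle R -> R[i]) (n : int).

Definition fourier f n : R[i] := cintegral m (fun z => f z * (z : R[i]) ^ (- n)).

Lemma normc_circle (z : circle R) : normc z = 1.
Proof. by case: z => z /= /eqP; rewrite normCE => -[]. Qed.

Lemma normc_circleX (z : circle R) n : normc ((z : R[i]) ^ n) = 1.
Proof.
have /(congr1 (@complex.Re _)) : `|(z : R[i]) ^ n| = 1.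
  case: n => k; first by rewrite normrX normCE normc_circle expr1n.
  by rewrite NegzE -exprnN normfV normrX normCE normc_circle expr1n invr1.
by rewrite normCE.
Qed.

Lemma measurable_circleX n : measurable_fun setT (fun z : circle R => (z : R[i]) ^ n).
Proof.
have mX k : measurable_fun setT (fun z : circle R => (z : R[i]) ^+ k).
  elim: k => [|k ih]; first exact: measurable_cst.
  under eq_fun do rewrite exprS.
  by apply: (measurable_complexM _ ih); exact: measurable_circle_val.
case: n => k; first exact: mX.
have inv (z : circle R) : (z : R[i]) ^ (Negz k) = conjc ((z : R[i]) ^+ k.+1).
  have z1 : `|(z : R[i]) ^+ k.+1| = 1 by rewrite normCE (normc_circleX z k.+1).
  rewrite NegzE -exprnN; set w := _ ^+ _ in z1 *.
  have w0 : w != 0 by rewrite -normr_eq0 z1 oner_eq0.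
  by apply: (mulfI w0); rewrite mulfV// -sqr_normc z1 expr1n.
under eq_fun do rewrite inv.
have /measurable_complexP[mr mi] := mX k.+1.
have ReJ w : complex.Re (conjc w) = complex.Re w :> R by case: w.
have ImJ w : complex.Im (conjc w) = - complex.Im w :> R by case: w.
apply/measurable_complexP; split.
  by under eq_fun do rewrite ReJ.
under eq_fun do rewrite ImJ.
exact: measurableT_comp.
Qed.

Variables (p : R) (p1 : 1 <= p).

Lemma fourier_integrand_integrable f n : f \in cLfun m p ->
  cintegrable m (fun z => f z * (z : R[i]) ^ (- n)).
Proof.
move=> fL; have /cLfunE[mf _] := fL.
have nfi : m.-integrable setT (EFin \o (fun z => normc (f z))).
  apply/Lfun1_integrable; apply: (@Lfun_subset _ _ _ m 1%E p%:E) => //.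
    exact: fin_num_measure.
  exact: cLnorm_normcLfun.
have /measurable_complexP[mr mi] :=
  measurable_complexM mf (measurable_circleX (- n)).
split; apply: le_integrable nfi => //; try exact/measurable_EFinP.
- move=> z _; rewrite lee_fin [leRHS]ger0_norm ?normc_ge0//.
  by rewrite (le_trans (normr_Re_le _))// normcM normc_circleX mulr1.
- move=> z _; rewrite lee_fin [leRHS]ger0_norm ?normc_ge0//.
  by rewrite (le_trans (normr_Im_le _))// normcM normc_circleX mulr1.
Qed.

Lemma fourierD f g n : f \in cLfun m p -> g \in cLfun m p ->
  fourier (f \+ g) n = fourier f n + fourier g n.
Proof.
move=> fL gL.
have fi := fourier_integrand_integrable n fL.
have gi := fourier_integrand_integrable n gL.
rewrite /fourier -cintegralD//.
by congr cintegral; apply/funext => z /=; rewrite mulrDl.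
Qed.

Lemma fourierZ a f n : f \in cLfun m p ->
  fourier (a \*: f) n = a * fourier f n.
Proof.
move=> fL; rewrite /fourier -cintegralZ; last exact: fourier_integrand_integrable.
by congr cintegral; apply/funext => z /=; rewrite mulrA.
Qed.

Lemma ae_eq_fourier f g n : measurable_fun setT f -> measurable_fun setT g ->
  f = g %[ae m] -> fourier f n = fourier g n.
Proof.
move=> mf mg fg; apply: ae_eq_cintegral.
- exact: measurable_complexM (measurable_circleX _).
- exact: measurable_complexM (measurable_circleX _).
- by apply: filterS fg => z /[apply] ->.
Qed.

Local Notation Lp := (cLspace m p1).

(* Does not depend on the representative: see cLfourierE. *)
Definition cLfourier (x : Lp) n := fourier (cLrepr x) n.

Lemma cLfourierE (h : cLfunType m p1) n : cLfourier (cLclass h) n = fourier h n.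
Proof.
have mh (h' : cLfunType m p1) : measurable_fun setT h'.
  by have /cLfunE[] := cLfun_valP h'.
by apply: ae_eq_fourier; [exact: mh|exact: mh|exact: cLclassK].
Qed.

Lemma cLfourier_linear n : linear_for *%R (fun x : Lp => cLfourier x n).
Proof.
move=> a x y; rewrite -(cLreprK x) -(cLreprK y) -linearP !cLfourierE.
rewrite -fourierZ ?cLfun_valP// -fourierD ?cLfun_valP//.
exact: (cLfun_valP (a *: cLrepr x)).
Qed.

Variable E : set int.

Definition spectrum_in : {pred Lp} :=
  mem [set x : Lp | forall n, ~ E n -> cLfourier x n = 0].

Lemma spectrum_in_submod_closed : submod_closed spectrum_in.
Proof.
split; rewrite ?inE /=.
  move=> n _; have := cLfourier_linear n (-1) 0 0.
  by rewrite scaler0 addr0 mulN1r addNr.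
move=> a x y; rewrite !inE /= => xE yE n nE.
by rewrite cLfourier_linear xE// yE// mulr0 addr0.
Qed.

HB.instance Definition _ :=
  GRing.isSubmodClosed.Build _ _ spectrum_in spectrum_in_submod_closed.

(* L^p_E(T), as a subspace of L^p(T). *)
Record LpE := MkLpE { LpE_val :> Lp ; LpE_valP : LpE_val \in spectrum_in }.
HB.instance Definition _ := [isSub for LpE_val].
HB.instance Definition _ := [Choice of LpE by <:].
HB.instance Definition _ := [SubChoice_isSubLmodule of LpE by <:].

Let LpE_norm (x : LpE) : R[i] := `|LpE_val x|.

Let LpE_normD x y : LpE_norm (x + y) <= LpE_norm x + LpE_norm y.
Proof. exact: ler_normD. Qed.

Let LpE_normZ (a : R[i]) x : LpE_norm (a *: x) = `|a| * LpE_norm x.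
Proof. exact: normrZ. Qed.

Let LpE_norm0_eq0 x : LpE_norm x = 0 -> x = 0.
Proof. by move=> /normr0_eq0 x0; exact: val_inj. Qed.

HB.instance Definition _ := Lmodule_isNormed.Build R[i] LpE
  LpE_normD LpE_normZ LpE_norm0_eq0.
End fourier.
Arguments LpE {R p} p1 E.

Section umap.
Variable K : numFieldType.

Definition finite_rank (U V : lmodType K) (T : U -> V) :=
  exists (r : nat) (v : 'I_r -> V),
    forall u, exists c : 'I_r -> K, T u = \sum_(i < r) c i *: v i.

Definition opnorm_le (U V : normedModType K) (T : U -> V) (M : K) :=
  forall u, `|T u| <= M * `|u|.

Definition bounded_op (U V : normedModType K) (T : U -> V) :=
  exists M, opnorm_le T M.

(* Intended for separable Banach spaces Y. Over K = R[i], `0 < e` forces e to be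
   real, the operators are complex linear, and the signs are +1 and -1. T 0 is
   the convention T_0 = 0; the approximating sequence proper is (T k), k >= 1. *)
Definition real_umap (Y : normedModType K) : Prop :=
  forall e : K, 0 < e -> exists T : nat -> {linear Y -> Y},
    [/\ T 0%N =1 (fun=> 0),
        forall k, bounded_op (T k) /\ finite_rank (T k),
        forall y, T k y @[k --> \oo] --> y &
        forall (n : nat) (s : nat -> K), (forall k, s k = 1 \/ s k = -1) ->
          opnorm_le (fun y => \sum_(1 <= k < n.+1) s k *: (T k y - T k.-1 y))
                    (1 + e)].
End umap.

Definition biquadrates : set int :=
  [set (k ^ 4)%N%:Z | k in [set k : nat | (1 <= k)%N]].

(* Main.v *)
(* If L^p_E has real umap with operators T_k, take the signs +1 up to k and -1 from
   k+1 to n: 2 T_k - T_n has norm at most 1 + e. Applied to f + g, with T_k f near f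
   and n large, this gives |f - g| <= (1 + e) |f + g| + e as soon as T_k g is small.
   Far-out characters z^n satisfy this: averages of M of them are small in L^p, so a
   bounded finite-rank operator cannot keep them away from 0. Hence |f + g| and |f - g|
   are asymptotically equal for f = z^81 and g a combination of far biquadratic characters.

   Ramanujan's identity 3^4 + a1 + a2 = b1 + b2 + b3, with biquadrates a1, a2, b1, b2, b3
   arbitrarily large, contradicts this unless p = 2 or p = 4. Let w be the sum of the five
   characters of frequencies a1 - 81, ..., b3 - 81 with signs and small amplitude r. In
   |1 + w|^p = sum_(i, j) binom(p/2, i) binom(p/2, j) w^i conj(w)^j, averaging against the
   product of the five signs leaves order r^5 and more; at order r^5 integration leaves
   only (i, j) = (2, 3) and (3, 2), whose coefficient binom(p/2, 2) binom(p/2, 3)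
   vanishes only for p = 2 and p = 4 (p >= 1): the pairs (0, 5), (1, 4), (4, 1), (5, 0)
   give no zero frequency, as each frequency is positive and less than the sum of the
   four others. *)

Require Import Defs.
From mathcomp Require Import all_boot all_order all_algebra complex.
From mathcomp Require Import all_classical all_reals all_analysis.
From mathcomp Require Import measurable_realfun ring lra zify.

Set Implicit Arguments.
Unset Strict Implicit.
Unset Printing Implicit Defensive.

Import Order.TTheory GRing.Theory Num.Theory Normc.
Import numFieldNormedType.Exports.

Local Open Scope classical_set_scope.
Local Open Scope complex_scope.
Local Open Scope ring_scope.

(** * Integration over the circle by passage to [0, 1] *)

Section haar_integral.
Variable R : realType.
Local Notation m := (@haar R).
Implicit Types (z : circle R) (t : R).

Lemma bounded_integrable (F : circle R -> R) (C : R) :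
  measurable_fun setT F -> (forall z, `|F z| <= C) ->
  m.-integrable setT (EFin \o F).
Proof.
move=> mF FC; apply: measurable_bounded_integrable => //.
  by apply: (le_lt_trans (probability_le1 _ _)) => //; rewrite ltry.
exists C; split; first exact: num_real.
by move=> x Cx z _ /=; exact: le_trans (FC z) (ltW Cx).
Qed.

Lemma Rintegral_haar (F : circle R -> R) (C : R) :
  measurable_fun setT F -> (forall z, `|F z| <= C) ->
  \int[m]_z F z = \int[lebesgue_measure]_(t in `[0, 1]) F (turn t).
Proof.
move=> mF FC; rewrite /Rintegral; congr fine.
pose leb01 := mrestr (@lebesgue_measure R) (measurable_itv `[0, 1]).
have mFt : measurable_fun setT (F \o @turn R).
  by apply: measurableT_comp => //; exact: measurable_turn.
have iFt : leb01.-integrable setT (EFin \o (F \o @turn R)).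
  apply: measurable_bounded_integrable => //.
    rewrite /leb01 /= /mrestr setTI lebesgue_measure_itv/=.
    by rewrite lte_fin ltr01 EFinN sube0 ltry.
  exists C; split; first exact: num_real.
  by move=> x Cx z _ /=; exact: le_trans (FC _) (ltW Cx).
rewrite integral_pushforward//; last 2 first.
- exact: measurable_turn.
- exact/measurable_EFinP.
rewrite preimage_setT.
pose D := [set` `[0, 1]%R] : set R.
(* [leb01] is a measure on the whole line: it does not charge the complement of [0, 1], and inside
   [0, 1] it is Lebesgue measure. *)
rewrite (@negligible_integral _ _ _ leb01 setT (~` D))//; last 2 first.
- apply: measurableC; exact: measurable_itv.
- by rewrite /leb01 /= /mrestr setICl measure0.
rewrite setTD setCK; apply: eq_measure_integral => A mA AD.
by rewrite /leb01 /= /mrestr setIidl.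
Qed.

Lemma turnX t (n : nat) :
  (turn t : R[i]) ^+ n = cos (2 * pi * t * n%:R) +i* sin (2 * pi * t * n%:R).
Proof.
rewrite /turn /=; elim: n => [|n IH].
  by rewrite mulr0 cos0 sin0 expr0.
have -> : 2 * pi * t * n.+1%:R = 2 * pi * t + 2 * pi * t * n%:R.
  by rewrite -[n.+1%:R]natr1; ring.
rewrite exprS IH cosD sinD /=.
by apply/eqP; rewrite eq_complex /=; apply/andP; split; apply/eqP; ring.
Qed.

Lemma continuous_scaled (f : R -> R) (c : R) : continuous f ->
  continuous (fun t => f (c * t)).
Proof.
move=> cf t; apply: continuous_comp; last exact: cf.
by apply: continuousM; [exact: cvg_cst|exact: cvg_id].
Qed.

(** The antiderivatives are sine and cosine of [c * t] up to a factor; they agree at 0 and 1 because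
    [c] is a multiple of the period 2 pi. *)
Lemma integral_cos_sin_turn (n : nat) : (0 < n)%N ->
  \int[lebesgue_measure]_(t in `[0, 1]) cos (2 * pi * n%:R * t) = 0 :> R /\
  \int[lebesgue_measure]_(t in `[0, 1]) sin (2 * pi * n%:R * t) = 0 :> R.
Proof.
move=> n0; set c := 2 * pi * n%:R.
have c0 : c != 0 by rewrite !mulf_neq0 ?pnatr_eq0 -?lt0n ?gt_eqF ?pi_gt0.
have cE : c = pi *+ n.*2 by rewrite /c -[RHS]mulr_natr -mul2n natrM; ring.
have per0 k : cos (pi *+ k.*2) = 1 :> R /\ sin (pi *+ k.*2) = 0 :> R.
  elim: k => [|k [IH1 IH2]]; first by rewrite cos0 sin0.
  rewrite doubleS mulrSr mulrSr -addrA -mulr2n -[pi *+ 2]mulr_natr.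
  rewrite [pi * 2]mulrC; rewrite cosD sinD IH1 IH2.
  by rewrite mulr_natl cos2pi sin2pi; split; ring.
have FTC (f F : R -> R) : continuous f ->
   (forall t : R, is_derive t 1 F (f t)) -> F 0 = F 1 ->
   \int[lebesgue_measure]_(t in `[0, 1]) f t = 0.
  move=> cf dF F01; rewrite /Rintegral.
  have dd t : derivable F t 1 by exact: (@ex_derive _ _ _ _ _ _ _ (dF t)).
  have cF : continuous F.
    by move=> t; apply/differentiable_continuous/derivable1_diffP.
  rewrite (@continuous_FTC2 _ f F)//; first by rewrite F01 -EFinB subrr.
  - by apply: continuous_subspaceT.
  - split=> //.
    + by apply: cvg_at_right_filter; exact: cF.
    + by apply: cvg_at_left_filter; exact: cF.
  - by move=> t _; rewrite derive1E; exact: derive_val.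
have mc (u : R) : is_derive u 1 (fun t : R => c * t) c.
  have := is_deriveZ c (is_derive_id u (1 : R)).
  by rewrite [c *: _]mulr1.
split.
- apply: (FTC _ (fun t => c^-1 * sin (c * t))).
  + apply: continuous_scaled; exact: continuous_cos.
  + move=> t.
    have := is_deriveZ c^-1 (is_derive1_comp (is_derive_sin (c * t)) (mc t)).
    by rewrite [_ *: (_ * _)]mulrCA mulVf// mulr1.
  + by rewrite mulr0 mulr1 cE !(proj2 (per0 _)) sin0.
- apply: (FTC _ (fun t => - c^-1 * cos (c * t))).
  + apply: continuous_scaled; exact: continuous_sin.
  + move=> t.
    have := is_deriveZ (- c^-1) (is_derive1_comp (is_derive_cos (c * t)) (mc t)).
    by rewrite [_ *: (_ * _)]mulrCA [- c^-1 * c]mulNr mulVf// mulrN1 opprK.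
  + by rewrite mulr0 mulr1 cE !(proj1 (per0 _)) cos0.
Qed.

End haar_integral.

(** * Orthogonality of characters and trigonometric polynomials *)

Section trigonometric_polynomials.
Variable R : realType.
Local Notation m := (@haar R).
Implicit Types (z : circle R) (n : int).

Lemma cintegrable_bounded (f : circle R -> R[i]) (C : R) :
  measurable_fun setT f -> (forall z, normc (f z) <= C) -> cintegrable m f.
Proof.
move=> /measurable_complexP[mr mi] fC; split.
  by apply: (bounded_integrable mr) => z; exact: le_trans (normr_Re_le _) (fC z).
by apply: (bounded_integrable mi) => z; exact: le_trans (normr_Im_le _) (fC z).
Qed.

Lemma conjc_circleX z n : conjc ((z : R[i]) ^ n) = (z : R[i]) ^ (- n).
Proof.
have z1 : `|(z : R[i]) ^ n| = 1 by rewrite normCE normc_circleX.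
have w0 : (z : R[i]) ^ n != 0 by rewrite -normr_eq0 z1 oner_eq0.
by rewrite -invr_expz; apply: (mulfI w0); rewrite mulfV// -sqr_normc z1 expr1n.
Qed.

Lemma circle_neq0 z : (z : R[i]) != 0.
Proof.
by apply/eqP => z0; have := normc_circle z; rewrite z0 normc0 => /eqP; rewrite eq_sym oner_eq0.
Qed.

(** Positive exponents reduce to the integrals of cosine and sine; negative ones follow by
    conjugation. *)
Lemma cintegral_circleX n :
  cintegral m (fun z => (z : R[i]) ^ n) = (n == 0)%:R.
Proof.
have pos (k : nat) : (0 < k)%N -> cintegral m (fun z => (z : R[i]) ^+ k) = 0.
  move=> k0; have /measurable_complexP[mr mi] := @measurable_circleX R k.
  have bX z : normc ((z : R[i]) ^+ k) <= 1 by rewrite (normc_circleX z k).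
  rewrite /cintegral (Rintegral_haar (C := 1) mr); last first.
    by move=> z; exact: le_trans (normr_Re_le _) (bX z).
  rewrite (Rintegral_haar (C := 1) mi); last first.
    by move=> z; exact: le_trans (normr_Im_le _) (bX z).
  have [c0 s0] := integral_cos_sin_turn R k0.
  apply/eqP; rewrite eq_complex /=; apply/andP; split; apply/eqP.
    rewrite -[RHS]c0; apply: eq_Rintegral => t _.
    by rewrite -exprnP turnX/=; congr cos; ring.
  rewrite -[RHS]s0; apply: eq_Rintegral => t _.
  by rewrite -exprnP turnX/=; congr sin; ring.
case: n => [[|k]|k].
- rewrite /cintegral; under eq_Rintegral do rewrite expr0z/=.
  under [X in _ +i* X]eq_Rintegral do rewrite expr0z/=.
  by rewrite !Rintegral_cst//= haar_setT/= mulr1 mul0r.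
- by rewrite [LHS]pos.
- have := pos k.+1 isT; rewrite NegzE /cintegral.
  under eq_Rintegral do rewrite exprnP.
  under [X in _ +i* X]eq_Rintegral do rewrite exprnP.
  move=> [re0 im0].
  have ReJ (w : R[i]) : complex.Re (conjc w) = complex.Re w by case: w.
  have ImJ (w : R[i]) : complex.Im (conjc w) = -1 * complex.Im w.
    by case: w => a b; rewrite /= mulN1r.
  under eq_Rintegral do rewrite -conjc_circleX ReJ.
  under [X in _ +i* X]eq_Rintegral do rewrite -conjc_circleX ImJ.
  rewrite re0 RintegralZl// ?im0 ?mulr0//.
  have [] := @cintegrable_bounded (fun z => (z : R[i]) ^ k.+1) 1 => //.
    exact: measurable_circleX.
  by move=> z; rewrite normc_circleX.
Qed.

Variables (I : Type) (a : I -> R[i]) (d : I -> int).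

(** Terms are indexed by an arbitrary type and frequencies may coincide, so that products can be
    indexed by pairs or by choice functions without collecting terms. *)
Definition trigpoly (s : seq I) z : R[i] := \sum_(i <- s) a i * (z : R[i]) ^ d i.

Lemma trigpoly_cons i s : trigpoly (i :: s) =
  (fun z => a i * (z : R[i]) ^ d i) \+ trigpoly s.
Proof. by apply/funext => z; rewrite /trigpoly big_cons. Qed.

Lemma measurable_trigpoly s : measurable_fun setT (trigpoly s).
Proof.
elim: s => [|i s IH].
  rewrite (_ : trigpoly _ = cst 0); first exact: measurable_cst.
  by apply/funext => z; rewrite /trigpoly big_nil.
rewrite trigpoly_cons; apply: measurable_complexD => //.
apply: (@measurable_complexM _ _ _ (cst (a i))); first exact: measurable_cst.
exact: measurable_circleX.
Qed.

Lemma normc_trigpoly s z : normc (trigpoly s z) <= \sum_(i <- s) normc (a i).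
Proof.
rewrite /trigpoly; elim: s => [|i s IH]; first by rewrite !big_nil normc0.
rewrite !big_cons (le_trans (le_normcD _ _))// lerD//.
by rewrite normcM normc_circleX mulr1.
Qed.

Lemma cintegral_trigpoly s :
  cintegral m (trigpoly s) = \sum_(i <- s | d i == 0) a i.
Proof.
rewrite big_mkcond /=; elim: s => [|i s IH].
  rewrite big_nil (_ : trigpoly _ = fun z => 0 * (z : R[i]) ^ (0 : int)).
    rewrite cintegralZ ?mul0r//; apply: (@cintegrable_bounded _ 1).
      exact: measurable_circleX.
    by move=> z; rewrite normc_circleX.
  by apply/funext => z; rewrite /trigpoly big_nil mul0r.
have iX : cintegrable m (fun z => (z : R[i]) ^ d i).
  apply: (@cintegrable_bounded _ 1); first exact: measurable_circleX.
  by move=> z; rewrite normc_circleX.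
rewrite trigpoly_cons cintegralD ?IH; last 2 first.
- apply: (@cintegrable_bounded _ (normc (a i))) => [|z].
    apply: (@measurable_complexM _ _ _ (cst (a i))); first exact: measurable_cst.
    exact: measurable_circleX.
  by rewrite normcM normc_circleX mulr1.
- by apply: cintegrable_bounded; [exact: measurable_trigpoly|exact: normc_trigpoly].
rewrite big_cons cintegralZ// cintegral_circleX.
by case: eqP => _; rewrite ?mulr1 ?mulr0.
Qed.

End trigonometric_polynomials.

(** * The square mean of a trigonometric polynomial *)

Section parseval.
Variable R : realType.
Local Notation m := (@haar R).

Lemma normc_sqr (w : R[i]) : normc w ^+ 2 = complex.Re (w * conjc w).
Proof.
by case: w => a b; rewrite /= sqr_sqrtr ?addr_ge0 ?sqr_ge0//; ring.
Qed.

Lemma normc_mul_conjc_trigpoly (I : Type) (a : I -> R[i]) (d : I -> int) s z :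
  trigpoly a d s z * conjc (trigpoly a d s z) =
  trigpoly (fun ij => a ij.1 * conjc (a ij.2)) (fun ij => d ij.1 - d ij.2)
    [seq (i, j) | i <- s, j <- s] z.
Proof.
rewrite /trigpoly big_allpairs_dep /= rmorph_sum big_distrl /=.
apply: eq_bigr => i _; rewrite big_distrr /=; apply: eq_bigr => j _.
by rewrite rmorphM/= conjc_circleX expfzDr ?circle_neq0//; ring.
Qed.

(** The square of the modulus is a polynomial indexed by pairs. As the frequencies are distinct,
    only diagonal pairs have frequency 0, and each contributes at most 1. *)
Lemma Rintegral_sqr_trigpoly_le (I : eqType) (a : I -> R[i]) (d : I -> int) s :
  uniq s -> {in s &, injective d} -> (forall i, normc (a i) <= 1) ->
  \int[m]_z (normc (trigpoly a d s z) ^+ 2) <= (size s)%:R.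
Proof.
move=> us dinj a1.
pose a2 (ij : I * I) := a ij.1 * conjc (a ij.2).
pose d2 (ij : I * I) := d ij.1 - d ij.2.
pose s2 := [seq (i, j) | i <- s, j <- s].
have -> : \int[m]_z (normc (trigpoly a d s z) ^+ 2) =
    complex.Re (cintegral m (trigpoly a2 d2 s2)).
  by apply: eq_Rintegral => z _; rewrite normc_sqr normc_mul_conjc_trigpoly.
rewrite cintegral_trigpoly big_mkcond big_allpairs_dep /=.
rewrite (eq_big_seq (fun i => a i * conjc (a i))); last first.
  move=> i si /=; rewrite -[LHS]big_mkcond/= -big_filter.
  rewrite (_ : [seq _ <- _ | _] = [:: i]) ?big_seq1//.
  rewrite -(filter_pred1_uniq us si); apply: eq_in_filter => j sj /=.
  by rewrite /d2 subr_eq0 (inj_in_eq dinj) 1?eq_sym.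
rewrite -sum1_size natr_sum raddf_sum/= ler_sum// => i _.
by rewrite -normc_sqr expr_le1// ?normc_ge0.
Qed.
End parseval.

(** * Characters as elements of L^p_E *)

Section characters.
Variables (R : realType) (p : R) (p1 : 1 <= p).
Local Notation m := (@haar R).

Lemma measurable_powR_normc (f : circle R -> R[i]) : measurable_fun setT f ->
  measurable_fun setT (fun z => normc (f z) `^ p).
Proof.
move=> mf; apply: (measurableT_comp (measurable_powR _)).
exact: measurable_normc.
Qed.

Lemma powR_normc_le (f : circle R -> R[i]) (C : R) z :
  (forall z, normc (f z) <= C) -> `|normc (f z) `^ p| <= C `^ p.
Proof.
move=> fC; rewrite ger0_norm ?powR_ge0//.
apply: ge0_ler_powR; rewrite ?nnegrE ?normc_ge0//.
  exact: le_trans p1.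
exact: le_trans (normc_ge0 _) (fC z).
Qed.

Lemma cLnorm_bounded (f : circle R -> R[i]) (C : R) :
  measurable_fun setT f -> (forall z, normc (f z) <= C) ->
  cLnorm m p f = ((\int[m]_z (normc (f z) `^ p)) `^ p^-1)%:E.
Proof.
move=> mf fC; rewrite /cLnorm unlock.
have /integrable_fin_num fin : m.-integrable setT (EFin \o (fun z => normc (f z) `^ p)).
  apply: (@bounded_integrable _ _ (C `^ p)); first exact: measurable_powR_normc.
  by move=> z; exact: powR_normc_le.
rewrite -poweR_EFin; congr (_ `^ _)%E.
rewrite /Rintegral fineK; last exact: fin.
apply: eq_integral => z _ /=.
by rewrite ger0_norm ?normc_ge0.
Qed.

Lemma cLfun_bounded (f : circle R -> R[i]) (C : R) :
  measurable_fun setT f -> (forall z, normc (f z) <= C) -> f \in cLfun m p.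
Proof.
by move=> mf fC; apply/cLfunE; split => //; rewrite (cLnorm_bounded mf fC) ltry.
Qed.

Lemma circleX_cLfun n : (fun z : circle R => (z : R[i]) ^ n) \in cLfun m p.
Proof.
apply: (@cLfun_bounded _ 1); first exact: measurable_circleX.
by move=> z; rewrite normc_circleX.
Qed.

Definition circleX n : cLfunType m p1 := CLfun p1 (circleX_cLfun n).

Lemma circleX_spectrum_in (E : set int) n : E n ->
  cLclass (circleX n) \in @spectrum_in R p p1 E.
Proof.
move=> En; rewrite inE => k kE.
rewrite cLfourierE /fourier (_ : (fun z => _) = fun z : circle R => (z : R[i]) ^ (n - k)).
  rewrite cintegral_circleX subr_eq0; case: eqP => // nk.
  by case: kE; rewrite -nk.
by apply/funext => z /=; rewrite expfzDr ?circle_neq0.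
Qed.

Definition character (E : set int) n (En : E n) : LpE p1 E :=
  MkLpE (circleX_spectrum_in En).

(** Turns norms in L^p_E into integrals of a power of a modulus, on which all estimates are made. *)
Lemma norm_sum_character (E : set int) (I : Type) (s : seq I) (a : I -> R[i])
    (d : I -> int) (dE : forall i, E (d i)) :
  `|\sum_(i <- s) a i *: character (dE i)| =
  ((\int[m]_z (normc (trigpoly a d s z) `^ p)) `^ p^-1)%:C.
Proof.
have valE : LpE_val (\sum_(i <- s) a i *: character (dE i)) =
    cLclass (\sum_(i <- s) a i *: circleX (d i)).
  rewrite -[LpE_val _]/(\val _) !raddf_sum; apply: eq_bigr => i _.
  by rewrite [LHS]linearZ [RHS]linearZ.
rewrite -[LHS]/(`|LpE_val _|) valE -[LHS]/(cLspace_norm _) cLspace_normE.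
have -> : (\sum_(i <- s) a i *: circleX (d i) : cLfunType m p1) =
    trigpoly a d s :> (circle R -> R[i]).
  apply/funext => z; rewrite /trigpoly.
  elim: s {valE} => [|i s IH]; first by rewrite !big_nil.
  by rewrite !big_cons -IH.
by rewrite (cLnorm_bounded (measurable_trigpoly _ _ _) (normc_trigpoly _ _ _)).
Qed.
End characters.

Lemma ger0_normc (R : realType) (r : R) : 0 <= r -> normc r%:C = r.
Proof. by move=> r0; rewrite /= expr0n/= addr0 sqrtr_sqr ger0_norm. Qed.

(** * Real-valued norms, finite spans and weakly null sequences *)

Section real_valued_norm.
Variables (R : realType) (V : normedModType R[i]).
Implicit Types (x y : V) (a : R[i]).

(* The norm of a normedModType over R[i] takes its values in R[i]; rnorm is the
   same number seen in R. *)
Definition rnorm x : R := complex.Re `|x|.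

Lemma rnormE x : `|x| = (rnorm x)%:C.
Proof.
rewrite /rnorm; have := normr_ge0 x.
by case: `|x| => u w; rewrite lecE /= => /andP[/eqP ->].
Qed.

Lemma rnorm_ge0 x : 0 <= rnorm x.
Proof. by have := normr_ge0 x; rewrite rnormE lecE /= => /andP[]. Qed.

Lemma rnormD x y : rnorm (x + y) <= rnorm x + rnorm y.
Proof. by rewrite -lecR rmorphD/= -!rnormE ler_normD. Qed.

Lemma rnormZ a x : rnorm (a *: x) = normc a * rnorm x.
Proof.
apply: (@complexI R); rewrite rmorphM/= -!rnormE normrZ.
by rewrite normCE.
Qed.

Lemma rnormN x : rnorm (- x) = rnorm x.
Proof. by rewrite /rnorm normrN. Qed.

Lemma rnormB x y : rnorm (x - y) <= rnorm x + rnorm y.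
Proof. by rewrite -(rnormN y) rnormD. Qed.

Lemma rnorm0 : rnorm 0 = 0.
Proof. by rewrite /rnorm normr0. Qed.

Lemma rnorm_sum (I : Type) (s : seq I) (F : I -> V) :
  rnorm (\sum_(i <- s) F i) <= \sum_(i <- s) rnorm (F i).
Proof.
elim: s => [|i s IH]; first by rewrite !big_nil rnorm0.
by rewrite !big_cons (le_trans (rnormD _ _))// lerD2l.
Qed.

(** The recursion on the generators allows them to be removed one at a time. *)
Fixpoint in_span (s : seq V) x : Prop :=
  if s is u :: s' then exists a y, in_span s' y /\ x = a *: u + y else x = 0.

Lemma in_span0 s : in_span s 0.
Proof. by elim: s => //= u s IH; exists 0, 0; rewrite scale0r addr0. Qed.

Lemma in_spanD s x y : in_span s x -> in_span s y -> in_span s (x + y).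
Proof.
elim: s x y => [|u s IH] x y /=; first by move=> -> ->; rewrite addr0.
move=> [a [x' [sx ->]]] [b [y' [sy ->]]]; exists (a + b), (x' + y').
by split; [exact: IH|rewrite scalerDl addrACA].
Qed.

Lemma in_spanZ s a x : in_span s x -> in_span s (a *: x).
Proof.
elim: s x => [|u s IH] x /=; first by move=> ->; rewrite scaler0.
move=> [b [y [sy ->]]]; exists (a * b), (a *: y).
by split; [exact: IH|rewrite scalerDr scalerA].
Qed.

Lemma in_span_sum (I : Type) (s : seq I) (c : I -> R[i]) (v : I -> V) :
  in_span (map v s) (\sum_(i <- s) c i *: v i).
Proof.
elim: s => [|i s IH] /=; first by rewrite big_nil.
by exists (c i), (\sum_(j <- s) c j *: v j); rewrite big_cons.
Qed.

(* Averages of distinct terms, with arbitrary phases, are uniformly small. For a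
   bounded sequence this implies weak convergence to 0. *)
Definition spread_null (x : nat -> V) := forall e : R, 0 < e ->
  exists2 M : nat, (0 < M)%N & forall (s : seq nat) (th : nat -> R[i]),
    uniq s -> size s = M -> (forall k, normc (th k) <= 1) ->
    rnorm (\sum_(k <- s) th k *: x k) <= e * M%:R.

Lemma uniq_seq_of_frequent (P : nat -> Prop) :
  (forall N, exists2 k, (N <= k)%N & P k) ->
  forall M, exists s : seq nat, [/\ uniq s, size s = M & forall k, k \in s -> P k].
Proof.
move=> PN; elim=> [|M [s [us sM sP]]]; first by exists [::].
have [k sk Pk] := PN (\max_(i <- s) i).+1.
exists (k :: s); split => /=; last first.
- by move=> j; rewrite inE => /orP[/eqP ->|/sP].
- by rewrite sM.
rewrite us andbT; apply/negP => ks.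
by move: sk; rewrite ltnNge (leq_bigmax_seq _ ks).
Qed.

(** The approximants vary with [k] and carry no bound. For the empty list this is convergence of [x]
    to 0. *)
Definition asymptotic_to (s : seq V) (x : nat -> V) := forall e : R, 0 < e ->
  exists N : nat, forall k, (N <= k)%N ->
  exists2 w, in_span s w & rnorm (x k - w) <= e.

(** Takes the place of a compactness argument in finite dimension. If [u] lies in the closure of the
    span of [s], it can be replaced by elements of that span. Otherwise [u] keeps a distance [d]
    from it, and large coefficients of [u] at infinitely many [k], once rotated to be positive,
    would add up to a sum too large for [spread_null]. *)
Lemma asymptotic_to_behead (u : V) (s : seq V) (x : nat -> V) :
  spread_null x -> asymptotic_to (u :: s) x -> asymptotic_to s x.
Proof.
move=> xnull xus.
have [u0|] := pselect (forall d : R, 0 < d ->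
    exists2 w, in_span s w & rnorm (u - w) <= d).
  move=> e e0; have e20 : 0 < e / 2 by lra.
  have [N xN] := xus _ e20; exists N => k /xN[_ [c [w [sw ->]]] xw].
  have c0 := normc_ge0 c.
  have d0 : 0 < e / 2 / (normc c + 1) by apply: divr_gt0; lra.
  have [w1 sw1 uw1] := u0 _ d0.
  exists (c *: w1 + w); first by apply: in_spanD => //; exact: in_spanZ.
  rewrite (_ : _ - _ = (x k - (c *: u + w)) + c *: (u - w1)); last first.
    by rewrite scalerBr ![_ + w]addrC !opprD !addrA addrNK.
  rewrite (le_trans (rnormD _ _))// rnormZ.
  rewrite [leRHS](_ : _ = e / 2 + e / 2); last by field.
  rewrite lerD// (le_trans (ler_wpM2l c0 uw1))// mulrCA ler_piMr ?(ltW e20)//.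
  by rewrite ler_pdivrMr; lra.
move=> /existsNP[d /not_implyP[d0 uw]] e e0.
have {}uw w : in_span s w -> d < rnorm (u - w).
  by move=> sw; rewrite ltNge; apply/negP => uwd; apply: uw; exists w.
have L0 := rnorm_ge0 u; set L := rnorm u in L0.
(* Chosen so that [eta + 2 * eta / d * L = e], the total error of the last case. *)
pose eta := e * d / (d + 2 * L).
have eta0 : 0 < eta by rewrite /eta divr_gt0 ?mulr_gt0//; lra.
have [N xN] := xus _ eta0.
have {xN}/choice[c /choice[w cw]] : forall k, exists (c : R[i]) (w : V),
    (N <= k)%N -> in_span s w /\ rnorm (x k - (c *: u + w)) <= eta.
  move=> k; have [/xN[_ [c [w [sw ->]]] xw]|Nk] := leqP N k.
    by exists c, w.
  by exists 0, 0.
have [M M0 xM] := xnull _ eta0.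
have [bad|] := pselect (forall N', exists2 k, (N' <= k)%N &
    (N <= k)%N /\ 2 * eta < normc (c k) * d).
  have [t [ut tM tbad]] := uniq_seq_of_frequent bad M.
  (* The phase that turns [c k] into its modulus. *)
  pose th k := if c k == 0 then 0 else conjc (c k) / (normc (c k))%:C.
  have thc k : th k * c k = (normc (c k))%:C.
    rewrite /th; case: eqP => [->|/eqP ck]; first by rewrite mul0r normc0.
    have ck0 : (normc (c k))%:C != 0 :> R[i] by rewrite -normCE normr_eq0.
    rewrite mulrAC [conjc _ * _]mulrC -sqr_normc normCE expr2 mulfK//.
  have th1 k : normc (th k) <= 1.
    have [ck|ck] := eqVneq (c k) 0; first by rewrite /th ck eqxx normc0.
    have n0 : 0 < normc (c k).
      rewrite lt_neqAle normc_ge0 andbT eq_sym.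
      by rewrite -(inj_eq (@complexI R)) -normCE normr_eq0.
    have /(congr1 (@normc R)) := thc k; rewrite normcM => /(canRL (mulfK _)) -> //.
      by rewrite ger0_normc ?normc_ge0// divff// gt_eqF.
    by rewrite gt_eqF.
  have := xM t th ut tM th1; rewrite leNgt => /negP; case.
  (* The rotated sum is within [eta * M] of [S *: u + w'], where [S] is the sum of the moduli. *)
  have [w' sw' wle] : exists2 w', in_span s w' & rnorm (\sum_(k <- t) th k *: x k
      - ((\sum_(k <- t) normc (c k))%:C *: u + w')) <= eta * (size t)%:R.
    elim: t tbad {ut tM} => [_|k t IH tbad].
      exists 0; first exact: in_span0.
      by rewrite !big_nil scale0r addr0 subr0 rnorm0 mulr0.
    have [|w' sw' wle] := IH.
      by move=> j jt; apply: tbad; rewrite inE jt orbT.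
    have [Nk _] := tbad k (mem_head _ _).
    have [swk xk] := cw k Nk.
    exists (th k *: w k + w'); first by apply: in_spanD => //; exact: in_spanZ.
    rewrite !big_cons rmorphD /= -thc scalerDl.
    set X := \sum_(j <- t) th j *: x j in wle *.
    set Y := (\sum_(j <- t) normc (c j))%:C *: u in wle *.
    rewrite (_ : _ - _ = th k *: (x k - (c k *: u + w k)) + (X - (Y + w'))).
      rewrite (le_trans (rnormD _ _))// -natr1 mulrDr mulr1 addrC lerD//.
      rewrite rnormZ (le_trans _ xk)// ler_piMl ?rnorm_ge0//.
    rewrite scalerBr scalerDr scalerA [RHS]addrACA -opprD.
    by rewrite [in RHS](addrACA (_ *: u)).
  set X := \sum_(j <- t) th j *: x j in wle *.
  set S := \sum_(j <- t) normc (c j) in wle *.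
  have Sge : 2 * eta * (size t)%:R <= S * d.
    rewrite /S -sum1_size natr_sum mulr_sumr mulr_suml !big_seq.
    by apply: ler_sum => k kt; have [_ /ltW] := tbad k kt; rewrite mulr1.
  have M0' : 0 < (M%:R : R) by rewrite ltr0n.
  have S0 : 0 < S.
    rewrite -(pmulr_lgt0 _ d0); apply: lt_le_trans Sge.
    by rewrite tM mulr_gt0// mulr_gt0// ltr0n.
  (* Scaled by [S], the distance from [u] to the span makes the norm of [S *: u + w'] exceed
     [S * d], hence [2 * eta * M]; but the rotated sum and the approximation error are each at most
     [eta * M]. *)
  have : d < rnorm (u - (- (S^-1)%:C *: w')).
    by apply: uw; exact: in_spanZ.
  rewrite -(ltr_pM2l S0).
  have -> : S * rnorm (u - (- (S^-1)%:C *: w')) = rnorm (S%:C *: u + w').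
    rewrite -{1}(ger0_normc (ltW S0)) -rnormZ scaleNr opprK scalerDr scalerA.
    by rewrite -rmorphM/= divff ?gt_eqF// scale1r.
  have := rnormB X (X - (S%:C *: u + w')); rewrite subKr.
  rewrite tM in wle Sge; nra.
(* From [N'] on the coefficient of [u] is small, and [c k *: u] is absorbed in the error. *)
move=> /existsNP[N' /forall2NP good]; exists (maxn N N') => k.
rewrite geq_max => /andP[Nk N'k]; have [swk xk] := cw k Nk.
exists (w k) => //.
have {good} cd : normc (c k) * d <= 2 * eta.
  by case: (good k) => // /not_andP[|/negP]; rewrite // -leNgt.
rewrite (_ : _ - _ = (x k - (c k *: u + w k)) + c k *: u); last first.
  by rewrite [_ *: _ + _]addrC opprD addrA addrNK.
rewrite (le_trans (rnormD _ _))// rnormZ -/L.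
apply: (@le_trans _ _ (eta + 2 * eta / d * L)).
  by rewrite lerD// ler_wpM2r// ler_pdivlMr.
by rewrite /eta le_eqVlt; apply/orP; left; apply/eqP; field; apply/andP; split; lra.
Qed.

(** Removing all generators one by one leaves a sequence asymptotic to the zero space. *)
Lemma finite_rank_spread_null (s : seq V) (x : nat -> V) :
  spread_null x -> (forall k, in_span s (x k)) ->
  forall e : R, 0 < e -> exists N : nat, forall k, (N <= k)%N -> rnorm (x k) <= e.
Proof.
move=> xnull xs.
have : asymptotic_to s x.
  by move=> e e0; exists 0%N => k _; exists (x k) => //; rewrite subrr rnorm0 ltW.
elim: s {xs} => [xs e /xs[N xN]|u s IH /(asymptotic_to_behead xnull)/IH//].
by exists N => k /xN[w /= ->]; rewrite subr0.
Qed.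

End real_valued_norm.

(** The bound [M] is a complex number, but its product with the norm of [u] dominates a norm, so it
    is nonnegative and equals its modulus. *)
Lemma opnorm_le_rnorm (R : realType) (U V : normedModType R[i]) (T : U -> V)
  (M : R[i]) : opnorm_le T M -> forall u, rnorm (T u) <= normc M * rnorm u.
Proof.
move=> TM u; have := TM u => h; rewrite -lecR rmorphM/= -!rnormE -normCE.
rewrite -[X in _ <= _ * X]normr_id -normrM ger0_norm//.
exact: le_trans h.
Qed.

(** * Changing the sign of far terms under real umap *)

Section umap_flip.
Variables (R : realType) (Y : normedModType R[i]).
Implicit Types (f y : Y) (x : nat -> Y).

Lemma spread_null_comp (T : {linear Y -> Y}) x :
  bounded_op T -> spread_null x -> spread_null (T \o x).
Proof.
move=> [M /opnorm_le_rnorm TM] xnull e e0.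
have M0 := normc_ge0 M.
have e'0 : 0 < e / (normc M + 1) by apply: divr_gt0; lra.
have [n n0 xn] := xnull _ e'0; exists n => // s th us sn th1.
have -> : \sum_(k <- s) th k *: (T \o x) k = T (\sum_(k <- s) th k *: x k).
  by rewrite raddf_sum; apply: eq_bigr => k _; rewrite /= linearZ.
rewrite (le_trans (TM _))//.
rewrite (le_trans (ler_wpM2l M0 (xn s th us sn th1)))// mulrA ler_wpM2r//.
by rewrite mulrA ler_pdivrMr; nra.
Qed.

(** The increments up to [k] add up to [a k], the later ones to [a n - a k], which enters with sign
    -1. *)
Lemma signed_telescope (a : nat -> Y) (k n : nat) : a 0%N = 0 ->
  \sum_(1 <= j < n.+1) (if (j <= k)%N then 1 else -1 : R[i]) *: (a j - a j.-1) =
  if (n <= k)%N then a n else a k *+ 2 - a n.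
Proof.
move=> a0; elim: n => [|n IH]; first by rewrite big_nil a0.
rewrite big_nat_recr//= IH; have [nk|kn|nk] := ltngtP n k.
- by rewrite scale1r addrC addrNK.
- by rewrite scaleN1r opprB addrA addrNK.
- by rewrite nk scaleN1r opprB mulr2n addrA.
Qed.

(* With k fixed and n large, the signs +1 up to k and -1 afterwards turn f + g
   into 2 T_k (f + g) - T_n (f + g), which is nearly f - g if T_k f is nearly f
   and T_k g nearly 0. *)
Lemma umap_flip f x (K : nat) : real_umap Y -> spread_null x ->
  forall e : R, 0 < e -> exists N : nat,
  forall (a : 'I_K -> R[i]) (k : 'I_K -> nat),
    (forall i, normc (a i) <= 1) -> (forall i, (N <= k i)%N) ->
    rnorm (f - \sum_i a i *: x (k i)) <=
      (1 + e) * rnorm (f + \sum_i a i *: x (k i)) + e.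
Proof.
move=> umapY xnull e e0.
have e0C : 0 < e%:C :> R[i] by rewrite ltcR.
have [T [T0 Tbf Tcvg Tsgn]] := umapY _ e0C.
have approx y (d : R) : 0 < d -> exists N, forall n, (N <= n)%N ->
    rnorm (T n y - y) <= d.
  move=> d0; have d0C : 0 < d%:C :> R[i] by rewrite ltcR.
  have /cvgrPdist_le/(_ _ d0C)[N _ Nd] := Tcvg y.
  by exists N => n /Nd; rewrite distrC rnormE lecR.
have e8 : 0 < e / 8 by lra.
have [k0 k0P] := approx f _ e8; pose k := k0.+1.
have Tkf : rnorm (T k f - f) <= e / 8 by exact: k0P.
have [Tb [r [v Tv]]] := Tbf k.
have Txnull := spread_null_comp Tb xnull.
(* Divides an error of [e / 8] among [K] terms; the successor keeps the denominator nonzero when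
   [K = 0]. *)
have eK : 0 < e / (8 * K.+1%:R) by rewrite divr_gt0// mulr_gt0// ltr0n.
have [|N NP] := @finite_rank_spread_null _ _ [seq v i | i <- enum 'I_r] _ Txnull _ _ eK.
  move=> j; have [c /= ->] := Tv (x j).
  by rewrite -big_enum; exact: in_span_sum.
exists N => a kk a1 kkN; set g := \sum_i a i *: x (kk i).
have Tkg : rnorm (T k g) <= e / 8.
  have -> : T k g = \sum_i a i *: T k (x (kk i)).
    by rewrite /g raddf_sum; apply: eq_bigr => i _; rewrite /= linearZ.
  rewrite (le_trans (rnorm_sum _ _))//.
  apply: (@le_trans _ _ (\sum_(i < K) e / (8 * K.+1%:R))).
    apply: ler_sum => i _; rewrite rnormZ.
    by rewrite (le_trans _ (NP _ (kkN i)))//= ler_piMl ?rnorm_ge0.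
  rewrite sumr_const card_ord -[leLHS]mulr_natr -[K.+1%:R]natr1.
  have K0 : 0 <= (K%:R : R) by exact: ler0n.
  by rewrite mulrAC ler_pdivrMr; nra.
(* The index [n] depends on [g], whereas [N] was fixed before the coefficients. *)
set y := f + g; have [n0 n0P] := approx y _ e8.
pose n := maxn n0 k.+1; have Tny : rnorm (T n y - y) <= e / 8.
  by apply: n0P; rewrite leq_maxl.
pose sgn j : R[i] := if (j <= k)%N then 1 else -1.
have sgn1 j : sgn j = 1 \/ sgn j = -1 by rewrite /sgn; case: ifP; [left|right].
have := Tsgn n sgn sgn1 y.
rewrite (@signed_telescope (fun j => T j y) k n) ?T0// ifF; last first.
  by apply/negbTE; rewrite -ltnNge leq_maxr.
rewrite !rnormE -(rmorph1 (real_complex R)) -rmorphD/= -rmorphM/= lecR => le1.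
(* The errors, one of [T n y - y] and two each of [T k f - f] and [T k g], total at most
   [5 * e / 8]. *)
rewrite (_ : f - g = (T k y *+ 2 - T n y) + ((T n y - y) +
  (- ((T k f - f) *+ 2) - T k g *+ 2))).
  rewrite (le_trans (rnormD _ _))// lerD// (le_trans (rnormD _ _))//.
  have := rnormB (- ((T k f - f) *+ 2)) (T k g *+ 2).
  rewrite rnormN !mulr2n.
  have := rnormD (T k f - f) (T k f - f); have := rnormD (T k g) (T k g).
  lra.
rewrite addrA [_ - T n y + _]addrA addrNK [T k y]linearD mulrnDl mulrnBl opprB.
rewrite -[_ - _ - _ *+ 2]addrA -opprD addrC addrA subrK.
by rewrite mulr2n /y opprD addrACA subrr add0r.
Qed.

End umap_flip.

(** * Taylor expansion of a real power near 1 *)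

Section binomial_expansion.
Variable R : realType.
Implicit Types (q s : R).

(** The generalized binomial coefficient. The recursion lowers [q] together with [k], as
    differentiation does. *)
Fixpoint gbin q (k : nat) : R :=
  if k is k'.+1 then q / k%:R * gbin (q - 1) k' else 1.

Lemma powR_near1_bounded q : exists C, forall s, `|s| <= 2^-1 ->
  (1 + s) `^ q <= C.
Proof.
exists (2^-1 `^ q + (3 / 2) `^ q) => s; rewrite ler_norml => /andP[s1 s2].
have h2 : 0 < 2^-1 :> R by lra.
have [q0|q0] := leP 0 q.
  apply: (@le_trans _ _ ((3 / 2) `^ q)); last by rewrite lerDr powR_ge0.
  by apply: ge0_ler_powR; rewrite ?nnegrE//; lra.
apply: (@le_trans _ _ (2^-1 `^ q)); last by rewrite lerDl powR_ge0.
rewrite -(opprK q) !(powRN _ (- q)) lef_pV2 ?posrE ?powR_gt0//; last by lra.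
by apply: ge0_ler_powR; rewrite ?nnegrE//; lra.
Qed.

Definition binomial_sum q (m : nat) s : R := \sum_(k < m) gbin q k * s ^+ k.

(** Differentiation sends the remainder of order [m.+1] for [q] to [q] times that of order [m] for
    [q - 1]; this drives the induction on the order. *)
Lemma is_derive_binomial_remainder q m s : `|s| <= 2^-1 ->
  is_derive s 1 (fun t : R => (1 + t) `^ q - binomial_sum q m.+1 t)
    (q * ((1 + s) `^ (q - 1) - binomial_sum (q - 1) m s)).
Proof.
rewrite ler_norml => /andP[s1 s2].
have s0 : 0 < 1 + s by lra.
have d1 : is_derive s 1 (fun t : R => 1 + t) 1.
  have := is_deriveD (is_derive_cst (1 : R) s 1) (is_derive_id s (1 : R)).
  by rewrite add0r.
have d2 := is_derive1_comp (is_derive1_powR q s0) d1.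
have d3 : is_derive s 1 (binomial_sum q m.+1) (q * binomial_sum (q - 1) m s).
  rewrite (_ : binomial_sum q m.+1 =
      \sum_(k < m.+1) (fun t : R => gbin q k * t ^+ k)); last first.
    by apply/funext => t; rewrite fct_sumE.
  have -> : q * binomial_sum (q - 1) m s =
      \sum_(k < m.+1) (gbin q k * (k%:R * s ^+ k.-1)).
    rewrite big_ord_recl /= mul0r mulr0 add0r /binomial_sum mulr_sumr.
    apply: eq_bigr => k _; rewrite /bump /= add1n add0n.
    by field; rewrite addrC natr1 pnatr_eq0.
  apply: is_derive_sum => k.
  have H := is_deriveZ (gbin q k) (is_deriveX k (is_derive_id s (1 : R))).
  move: H; rewrite [_%:A]mulr1; congr is_derive.
  by apply/funext => t; rewrite /= exprfctE.
have := is_deriveB d2 d3.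
by rewrite mulr1 mulrBr.
Qed.

(** The remainder vanishes at 0 and its derivative is bounded by induction, so the mean value
    theorem gains one factor of the modulus of [s]. *)
Lemma binomial_taylor (m : nat) q : exists2 C : R, 0 <= C & forall s, `|s| <= 2^-1 ->
  `|(1 + s) `^ q - binomial_sum q m s| <= C * `|s| ^+ m.
Proof.
elim: m q => [|m IH] q.
  have [C Cq] := powR_near1_bounded q; exists C.
    by apply: le_trans (Cq 0 _); rewrite ?powR_ge0// normr0; lra.
  move=> s s1; rewrite /binomial_sum big_ord0 subr0 expr0 mulr1.
  by rewrite ger0_norm ?powR_ge0// Cq.
have [C C0 CP] := IH (q - 1); exists (`|q| * C); first by rewrite mulr_ge0.
move=> s s1; pose G (t : R) := (1 + t) `^ q - binomial_sum q m.+1 t.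
have G0 : G 0 = 0.
  rewrite /G /binomial_sum addr0 powR1 big_ord_recl /= expr0 mulr1 big1 ?addr0 ?subrr//.
  by move=> i _; rewrite expr0n /= mulr0.
have dG (t : R) : `|t| <= 2^-1 -> is_derive t 1 G
    (q * ((1 + t) `^ (q - 1) - binomial_sum (q - 1) m t)).
  exact: is_derive_binomial_remainder.
have mvt (a b : R) : a <= b -> (forall t, t \in `[a, b] -> `|t| <= `|s|) ->
    `|G b - G a| <= `|q| * C * `|s| ^+ m * (b - a).
  move=> ab abs.
  have abs2 (t : R) : t \in `[a, b] -> `|t| <= 2^-1.
    by move=> /abs ts; exact: le_trans s1.
  have cG : {within `[a, b], continuous G}.
    apply: derivable_within_continuous => t /abs2/dG ?.
    exact: ex_derive.
  have dGoo (t : R) : t \in `]a, b[ -> is_derive t 1 G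
      (q * ((1 + t) `^ (q - 1) - binomial_sum (q - 1) m t)).
    by move=> tab; apply/dG/abs2; exact: subset_itv_oo_cc tab.
  have [c cab ->] := MVT_segment ab dGoo cG.
  rewrite normrM normrM (@ger0_norm _ (b - a)) ?subr_ge0//.
  rewrite ler_wpM2r ?subr_ge0// -!mulrA ler_wpM2l//.
  rewrite (le_trans (CP _ (abs2 _ cab)))// ler_wpM2l//.
  by apply: lerXn2r; rewrite ?nnegrE ?normr_ge0// abs.
rewrite -/(G s) exprSr mulrA.
have [s0|s0] := leP 0 s.
  have := mvt 0 s s0; rewrite G0 !subr0 (ger0_norm s0); apply=> t.
  by rewrite in_itv/= => /andP[t0 ts]; rewrite ger0_norm.
have := mvt s 0 (ltW s0); rewrite G0 !sub0r normrN (ltr0_norm s0).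
apply=> t; rewrite in_itv/= => /andP[st t0].
by rewrite ler0_norm ?lerN2.
Qed.

End binomial_expansion.

(** * Expansion of the p-th power of |1 + w| to order 5 *)

Section power_of_modulus.
Variables (R : realType) (p : R).
Local Notation b := (@gbin R (p / 2)).
Implicit Types (x y rho : R).

(* The part of weight at most 5 of the Taylor sum of (1 + (x + y))^(p/2), where
   x = w + conj w has weight 1 and y = w * conj w has weight 2. *)
Definition quintic_part x y : R :=
  b 0 + b 1 * (x + y) + b 2 * (x + y) ^+ 2
  + b 3 * (x ^+ 3 + 3 * x ^+ 2 * y + 3 * x * y ^+ 2)
  + b 4 * (x ^+ 4 + 4 * x ^+ 3 * y) + b 5 * x ^+ 5.

Lemma weighted_monomial_le x y rho i j : 0 <= rho <= 1 -> `|x| <= 2 * rho ->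
  `|y| <= rho ^+ 2 -> (6 <= i + 2 * j)%N ->
  `|x ^+ i * y ^+ j| <= 2 ^+ i * rho ^+ 6.
Proof.
move=> /andP[r0 r1] xr yr ij; rewrite normrM !normrX.
apply: (@le_trans _ _ ((2 * rho) ^+ i * (rho ^+ 2) ^+ j)).
  apply: ler_pM; rewrite ?exprn_ge0//; apply: lerXn2r; rewrite ?nnegrE//.
    by rewrite mulr_ge0.
  by rewrite exprn_ge0.
rewrite exprMn -mulrA -exprM -exprD ler_wpM2l ?exprn_ge0//.
exact: ler_wiXn2l.
Qed.

(** The difference consists of the monomials of weight at least 6; the constant sums their
    coefficients, with a factor 2 for each [x]. *)
Lemma quintic_part_close : exists2 C : R, 0 <= C & forall x y rho,
  0 <= rho <= 1 -> `|x| <= 2 * rho -> `|y| <= rho ^+ 2 ->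
  `|binomial_sum (p / 2) 6 (x + y) - quintic_part x y| <= C * rho ^+ 6.
Proof.
exists (`|b 3| * 1 + `|b 4| * (6 * 2 ^+ 2 + 4 * 2 + 1)
  + `|b 5| * (5 * 2 ^+ 4 + 10 * 2 ^+ 3 + 10 * 2 ^+ 2 + 5 * 2 + 1)).
  by rewrite !addr_ge0// mulr_ge0// ?addr_ge0.
move=> x y rho rho01 xr yr.
rewrite (_ : _ - _ = b 3 * (1 * (x ^+ 0 * y ^+ 3))
    + b 4 * (6 * (x ^+ 2 * y ^+ 2) + 4 * (x ^+ 1 * y ^+ 3) + 1 * (x ^+ 0 * y ^+ 4))
    + b 5 * (5 * (x ^+ 4 * y ^+ 1) + 10 * (x ^+ 3 * y ^+ 2)
       + 10 * (x ^+ 2 * y ^+ 3) + 5 * (x ^+ 1 * y ^+ 4) + 1 * (x ^+ 0 * y ^+ 5)));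
  last first.
  rewrite /binomial_sum /quintic_part; move: (gbin (p / 2)) => B.
  by rewrite !big_ord_recl big_ord0 /=; ring.
have triangle (u v U V : R) : `|u| <= U * rho ^+ 6 -> `|v| <= V * rho ^+ 6 ->
    `|u + v| <= (U + V) * rho ^+ 6.
  by move=> uU vV; rewrite mulrDl (le_trans (ler_normD _ _))// lerD.
have scale (k u U : R) : `|u| <= U * rho ^+ 6 -> `|k * u| <= `|k| * U * rho ^+ 6.
  by move=> uU; rewrite normrM -mulrA ler_wpM2l.
have mono i j (k : R) : (6 <= i + 2 * j)%N -> 0 <= k ->
    `|k * (x ^+ i * y ^+ j)| <= k * 2 ^+ i * rho ^+ 6.
  move=> ij k0; rewrite normrM ger0_norm// -mulrA ler_wpM2l//.
  exact: weighted_monomial_le.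
have mono0 j : (6 <= 2 * j)%N -> `|1 * (x ^+ 0 * y ^+ j)| <= 1 * rho ^+ 6.
  by move=> j6; have := @mono 0%N j 1 j6 ler01; rewrite mulr1.
have mono1 j (k : R) : (6 <= 1 + 2 * j)%N -> 0 <= k ->
    `|k * (x ^+ 1 * y ^+ j)| <= k * 2 * rho ^+ 6.
  by move=> j6 k0; have := @mono 1%N j k j6 k0; rewrite expr1.
by repeat first [apply: (triangle)|apply: (scale)|apply: (mono0)|apply: (mono1)|apply: (mono)].
Qed.

Lemma normc_1D_sqr (w : R[i]) :
  normc (1 + w) ^+ 2 = 1 + (2 * complex.Re w + normc w ^+ 2).
Proof.
case: w => u v; rewrite /= !sqr_sqrtr ?addr_ge0 ?sqr_ge0//.
by ring.
Qed.

Lemma normc_1D_powR (w : R[i]) :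
  normc (1 + w) `^ p = (1 + (2 * complex.Re w + normc w ^+ 2)) `^ (p / 2).
Proof.
rewrite -normc_1D_sqr -powR_mulrn ?normc_ge0// -powRrM.
by congr (_ `^ _); field.
Qed.

(** The square of |1 + w| is 1 + s with |s| at most 3 |w|; the radius 1/6 puts s within the range
    1/2 of the binomial estimate. *)
Lemma normc_1D_taylor : exists2 C : R, 0 <= C & forall w : R[i],
  normc w <= 6^-1 ->
  `|normc (1 + w) `^ p - quintic_part (2 * complex.Re w) (normc w ^+ 2)| <=
    C * normc w ^+ 6.
Proof.
have [C1 C10 C1P] := binomial_taylor 6 (p / 2).
have [C2 C20 C2P] := quintic_part_close.
exists (C1 * 3 ^+ 6 + C2); first by rewrite addr_ge0// mulr_ge0.
move=> w w6; have rho0 := normc_ge0 w; set rho := normc w in w6 rho0 *.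
rewrite normc_1D_powR -/rho; set x := 2 * _; set y := rho ^+ 2.
have xr : `|x| <= 2 * rho by rewrite normrM ger0_norm// ler_wpM2l// normr_Re_le.
have yr : `|y| <= rho ^+ 2 by rewrite ger0_norm ?exprn_ge0.
have rho1 : 0 <= rho <= 1 by apply/andP; split => //; lra.
have sr : `|x + y| <= 3 * rho.
  by rewrite (le_trans (ler_normD _ _))//; nra.
rewrite (_ : _ - _ = ((1 + (x + y)) `^ (p / 2) - binomial_sum (p / 2) 6 (x + y))
  + (binomial_sum (p / 2) 6 (x + y) - quintic_part x y)); last by ring.
rewrite (le_trans (ler_normD _ _))// mulrDl lerD//; last exact: C2P.
rewrite (le_trans (C1P _ _))//; first by lra.
rewrite -mulrA -exprMn ler_wpM2l//; apply: lerXn2r; rewrite ?nnegrE//.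
by rewrite mulr_ge0.
Qed.

End power_of_modulus.

(** * Polarization by sums over signs *)

Section polarization.
Variables (K : comNzRingType) (n : nat).
Implicit Types (e : {ffun 'I_n -> bool}) (u v : 'I_n -> K).

(** An unnormalized Walsh coefficient, at the product of all signs; [true] stands for the sign
    -1. *)
Definition signed_sum (F : {ffun 'I_n -> bool} -> K) : K :=
  \sum_(e : {ffun 'I_n -> bool}) (\prod_(k < n) (-1) ^+ e k) * F e.

Definition sign_comb u e : K := \sum_k (-1) ^+ e k * u k.

Lemma signed_sumZ (c : K) F : signed_sum (fun e => c * F e) = c * signed_sum F.
Proof. by rewrite /signed_sum mulr_sumr; apply: eq_bigr => e _; rewrite mulrCA. Qed.

Lemma signed_sumD F G :
  signed_sum (fun e => F e + G e) = signed_sum F + signed_sum G.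
Proof. by rewrite -big_split; apply: eq_bigr => e _; rewrite mulrDr. Qed.

Lemma eq_signed_sum F G : F =1 G -> signed_sum F = signed_sum G.
Proof. by move=> FG; apply: eq_bigr => e _; rewrite FG. Qed.

(** The sum factors over the signs. The exponent of sign [k] is the number of times [f] takes the
    value [k], plus one from the weight. *)
Lemma signed_sum_prod_signs m (f : {ffun 'I_m -> 'I_n}) :
  signed_sum (fun e => \prod_j (-1) ^+ e (f j)) =
  \prod_k \sum_(b : bool) ((-1) ^+ b) ^+ (#|[pred j | f j == k]|).+1.
Proof.
rewrite bigA_distr_bigA; apply: eq_bigr => e _.
rewrite (partition_big f xpredT)//= -big_split /=; apply: eq_bigr => k _.
rewrite exprS; congr (_ * _); rewrite -prodr_const.
by apply: eq_bigr => j /eqP ->.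
Qed.

(** A value missed by [f] gives the factor -1 + 1. *)
Lemma signed_sum_prod_signs0 m (f : {ffun 'I_m -> 'I_n}) :
  (#|codom f| < n)%N -> signed_sum (fun e => \prod_j (-1) ^+ e (f j)) = 0.
Proof.
move=> fn; have /subsetPn[k _ kf] : ~~ ('I_n \subset codom f).
  by apply/negP => /subset_leq_card; rewrite leqNgt card_ord fn.
rewrite signed_sum_prod_signs (bigD1 k)//= [X in X * _](_ : _ = 0) ?mul0r//.
rewrite eq_card0 => [|j]; last first.
  by rewrite !inE; apply/negP => /eqP fj; move: kf; rewrite -fj codom_f.
by rewrite big_bool/= !expr1 addNr.
Qed.

Lemma signed_sum_prod_signs_inj (f : {ffun 'I_n -> 'I_n}) : injective f ->
  signed_sum (fun e => \prod_j (-1) ^+ e (f j)) = 2 ^+ n.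
Proof.
move=> finj; rewrite signed_sum_prod_signs (eq_bigr (fun=> 2 : K)).
  by rewrite prodr_const card_ord.
move=> k _; have -> : #|[pred j | f j == k]| = 1%N.
  rewrite -(card1 (invF finj k)); apply: eq_card => j.
  by rewrite !inE -(inj_eq finj) f_invF.
by rewrite big_bool /= !sqrr_sign.
Qed.

Lemma signed_sum_prod m (y : 'I_m -> 'I_n -> K) :
  signed_sum (fun e => \prod_j sign_comb (y j) e) =
  \sum_(f : {ffun 'I_m -> 'I_n})
    signed_sum (fun e => \prod_j (-1) ^+ e (f j)) * \prod_j y j (f j).
Proof.
rewrite /signed_sum.
under eq_bigr do rewrite bigA_distr_bigA mulr_sumr.
rewrite exchange_big /=; apply: eq_bigr => f _.
by rewrite mulr_suml; apply: eq_bigr => e _; rewrite big_split mulrA.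
Qed.

Lemma sign_comb_monomial i j u v e :
  sign_comb u e ^+ i * sign_comb v e ^+ j =
  \prod_(l < i + j) sign_comb (if (l < i)%N then u else v) e.
Proof.
rewrite big_split_ord /=; congr (_ * _).
  rewrite -[in LHS](card_ord i) -prodr_const.
  by apply: eq_bigr => l _; rewrite ltn_ord.
rewrite -[in LHS](card_ord j) -prodr_const.
by apply: eq_bigr => l _; rewrite ltnNge leq_addr.
Qed.

Lemma signed_sum_monomial0 i j u v : (i + j < n)%N ->
  signed_sum (fun e => sign_comb u e ^+ i * sign_comb v e ^+ j) = 0.
Proof.
move=> ijn; under eq_signed_sum do rewrite sign_comb_monomial.
rewrite signed_sum_prod big1// => f _.
rewrite signed_sum_prod_signs0 ?mul0r//.
apply: leq_ltn_trans ijn; rewrite -[leqRHS]card_ord.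
by rewrite (leq_trans (card_size _))// size_codom.
Qed.

(** In degree [n] exactly the permutations use every sign; all other choices miss one and cancel. *)
Lemma signed_sum_monomial i j u v : (i + j)%N = n ->
  signed_sum (fun e => sign_comb u e ^+ i * sign_comb v e ^+ j) =
  2 ^+ n * \sum_(f : {ffun 'I_n -> 'I_n} | injectiveb f)
    \prod_(l < n) (if (l < i)%N then u else v) (f l).
Proof.
move=> ijn; under eq_signed_sum do rewrite sign_comb_monomial ijn.
rewrite signed_sum_prod [in RHS]big_mkcond mulr_sumr; apply: eq_bigr => f _.
case: ifPn => [/injectiveP/signed_sum_prod_signs_inj -> //|fninj].
rewrite signed_sum_prod_signs0 ?mul0r ?mulr0// ltnNge.
apply: contra fninj => nf; rewrite /injectiveb /dinjectiveb.
apply/card_uniqP; rewrite -[RHS]/(size (codom f)) size_codom card_ord.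
apply/eqP; rewrite eqn_leq nf andbT.
by have := max_card (mem (codom f)); rewrite [X in (_ <= X)%N]card_ord.
Qed.

End polarization.

(** * Isolation of the terms of degree 5 *)

Section quintic_extraction.
Variable K : comNzRingType.
Implicit Types (b : nat -> K) (w v : K).

(** Coefficients and exponents of the monomials of degree at most 4 in [w] and [v], after the
    substitution [x = w + v], [y = w * v]. *)
Definition low_terms b : seq (K * (nat * nat)) :=
  [:: (b 0%N, (0, 0)%N); (b 1%N, (1, 0)%N); (b 1%N, (0, 1)%N); (b 1%N + 2 * b 2%N, (1, 1)%N);
      (b 2%N, (2, 0)%N); (b 2%N, (0, 2)%N); (2 * b 2%N + 3 * b 3%N, (2, 1)%N);
      (2 * b 2%N + 3 * b 3%N, (1, 2)%N); (b 2%N + 6 * b 3%N + 6 * b 4%N, (2, 2)%N);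
      (b 3%N, (3, 0)%N); (b 3%N, (0, 3)%N); (3 * b 3%N + 4 * b 4%N, (3, 1)%N);
      (3 * b 3%N + 4 * b 4%N, (1, 3)%N); (b 4%N, (4, 0)%N); (b 4%N, (0, 4)%N)].

(** The coefficient of [w ^+ i * v ^+ (5 - i)]. When [b] lists the binomial coefficients of q, it
    equals binom(q, i) binom(q, 5 - i). *)
Definition top_coef b (i : nat) : K :=
  nth 0 [:: b 5%N; 5 * b 5%N + 4 * b 4%N; 10 * b 5%N + 12 * b 4%N + 3 * b 3%N;
            10 * b 5%N + 12 * b 4%N + 3 * b 3%N; 5 * b 5%N + 4 * b 4%N; b 5%N] i.

Lemma quintic_expansion b w v (x := w + v) (y := w * v) :
  b 0%N + b 1%N * (x + y) + b 2%N * (x + y) ^+ 2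
  + b 3%N * (x ^+ 3 + 3 * x ^+ 2 * y + 3 * x * y ^+ 2)
  + b 4%N * (x ^+ 4 + 4 * x ^+ 3 * y) + b 5%N * x ^+ 5 =
  \sum_(t <- low_terms b) t.1 * (w ^+ t.2.1 * v ^+ t.2.2) +
  \sum_(i < 6) top_coef b i * (w ^+ i * v ^+ (5 - i)).
Proof.
by rewrite /x /y /low_terms /top_coef !big_cons big_nil !big_ord_recl big_ord0 /=; ring.
Qed.

Lemma signed_sum_sum n (I : Type) (s : seq I) (F : I -> {ffun 'I_n -> bool} -> K) :
  signed_sum (fun e => \sum_(i <- s) F i e) = \sum_(i <- s) signed_sum (F i).
Proof.
elim: s => [|i s IH].
  rewrite big_nil /signed_sum big1// => e _.
  by rewrite big_nil mulr0.
by rewrite big_cons -IH -signed_sumD; apply: eq_signed_sum => e; rewrite big_cons.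
Qed.

Lemma signed_sum_quintic b (u v : 'I_5 -> K) :
  signed_sum (fun e => let x := sign_comb u e + sign_comb v e in
    let y := sign_comb u e * sign_comb v e in
    b 0%N + b 1%N * (x + y) + b 2%N * (x + y) ^+ 2
    + b 3%N * (x ^+ 3 + 3 * x ^+ 2 * y + 3 * x * y ^+ 2)
    + b 4%N * (x ^+ 4 + 4 * x ^+ 3 * y) + b 5%N * x ^+ 5) =
  2 ^+ 5 * \sum_(i < 6) top_coef b i *
    \sum_(f : {ffun 'I_5 -> 'I_5} | injectiveb f)
      \prod_(l < 5) (if (l < i)%N then u else v) (f l).
Proof.
rewrite (eq_signed_sum (fun e => quintic_expansion b (sign_comb u e) (sign_comb v e))).
rewrite signed_sumD signed_sum_sum [X in X + _]big1_seq ?add0r; last first.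
  move=> t /andP[_ tlow]; rewrite signed_sumZ signed_sum_monomial0 ?mulr0//.
  have /allP/(_ _ (map_f snd tlow)) : all (fun ij => ij.1 + ij.2 < 5)%N (map snd (low_terms b)).
    by [].
  by [].
rewrite signed_sum_sum mulr_sumr; apply: eq_bigr => i _.
rewrite signed_sumZ signed_sum_monomial 1?mulrCA//.
by rewrite subnKC// -ltnS.
Qed.
End quintic_extraction.

(** * Frequencies of the terms of degree 5 *)

Section trigonometric_quintic.
#[local] Arguments gbin : simpl never.
Variables (R : realType) (p : R).
Local Notation m := (@haar R).
Local Notation b := (@gbin R (p / 2)).
Implicit Types (z : circle R) (e : {ffun 'I_5 -> bool}).

Definition lacunary (mu : 'I_5 -> int) (r : R) e z : R[i] :=
  sign_comb (fun k => r%:C * (z : R[i]) ^ mu k) e.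

(** The exponent of z in the term of w^i conj(w)^(5 - i) whose [l]-th factor has frequency
    [mu (f l)], up to sign. *)
Definition net_frequency (mu : 'I_5 -> int) (i : nat) (f : {ffun 'I_5 -> 'I_5}) : int :=
  \sum_(l < 5) (if (l < i)%N then mu (f l) else - mu (f l)).

(** Maps that are not injective are kept with coefficient 0, so that the index set is a plain
    product. *)
Definition quintic_coef (r : R) (t : 'I_6 * {ffun 'I_5 -> 'I_5}) : R :=
  if injectiveb t.2 then 2 ^+ 5 * top_coef b t.1 * r ^+ 5 else 0.

Lemma conjc_lacunary mu r e z :
  conjc (lacunary mu r e z) = sign_comb (fun k => r%:C * (z : R[i]) ^ (- mu k)) e.
Proof.
rewrite /lacunary /sign_comb rmorph_sum /=; apply: eq_bigr => k _.
rewrite !rmorphM rmorphXn rmorphN1 /= conjc_circleX.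
by congr (_ * (_ * _)); rewrite /= oppr0.
Qed.

Lemma signed_sum_lacunary mu r z :
  (signed_sum (fun e => quintic_part p (2 * complex.Re (lacunary mu r e z))
     (normc (lacunary mu r e z) ^+ 2)))%:C =
  trigpoly (fun t => (quintic_coef r t)%:C) (fun t => net_frequency mu t.1 t.2)
    (index_enum _) z.
Proof.
rewrite /trigpoly rmorph_sum /=.
transitivity (signed_sum (fun e => (quintic_part p (2 * complex.Re (lacunary mu r e z))
     (normc (lacunary mu r e z) ^+ 2))%:C)).
  apply: eq_bigr => e _; rewrite rmorphM rmorph_prod; congr (_ * _).
  by apply: eq_bigr => k _; rewrite rmorphXn rmorphN1.
pose u k := r%:C * (z : R[i]) ^ mu k.
pose v k := r%:C * (z : R[i]) ^ (- mu k).
have /= := signed_sum_quintic (fun k => (b k)%:C) u v.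
rewrite -[X in X = _ -> _](@eq_signed_sum _ _
    (fun e => (quintic_part p (2 * complex.Re (lacunary mu r e z))
      (normc (lacunary mu r e z) ^+ 2))%:C)); last first.
  move=> e; have uE : sign_comb u e = lacunary mu r e z by [].
  have vE : sign_comb v e = conjc (lacunary mu r e z) by rewrite conjc_lacunary.
  have <- : (2 * complex.Re (lacunary mu r e z))%:C = sign_comb u e + sign_comb v e.
    rewrite uE vE; case: (lacunary _ _ _ _) => s t /=.
    by apply/eqP; rewrite eq_complex /= subrr eqxx andbT mulr_natl mulr2n.
  have <- : (normc (lacunary mu r e z) ^+ 2)%:C = sign_comb u e * sign_comb v e.
    by rewrite uE vE rmorphXn /= -normCE sqr_normc.
  rewrite /quintic_part; move: (b 0) (b 1) (b 2) (b 3) (b 4) (b 5) (2 * _) (_ ^+ 2).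
  by move=> b0 b1 b2 b3 b4 b5 x y; ring.
move=> ->.
rewrite mulr_sumr; rewrite -[RHS](pair_bigA _ (fun (i : 'I_6) (f : {ffun 'I_5 -> 'I_5}) =>
  (quintic_coef r (i, f))%:C * (z : R[i]) ^ net_frequency mu i f)) /=.
apply: eq_bigr => i _; rewrite mulrA mulr_sumr big_mkcond; apply: eq_bigr => f _ /=.
rewrite /quintic_coef /=; case: ifP => _; last by rewrite mul0r.
have -> : \prod_(l < 5) (if (l < i)%N then u else v) (f l) =
    r%:C ^+ 5 * (z : R[i]) ^ net_frequency mu i f.
  have -> : r%:C ^+ 5 = \prod_(l < 5) r%:C by rewrite prodr_const card_ord.
  rewrite /net_frequency (big_morph _ (fun d1 d2 => expfzDr d1 d2 (circle_neq0 z))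
    (expr0z _)) -big_split /=.
  by apply: eq_bigr => l _; case: ifP.
have -> : top_coef (fun k => (b k)%:C) i = (top_coef b i)%:C.
  rewrite /top_coef; move: (b 3) (b 4) (b 5) => b3 b4 b5.
  by case: i => -[|[|[|[|[|[|]]]]]] //= _; ring.
by rewrite mulrA; congr (_ * _); ring.
Qed.

(** For [i] equal to 0 or 5 all signs agree. For 1 or 4 one frequency, at the first or the last
    position, opposes the other four and is smaller than their sum. Only 2 and 3 remain, and their
    coefficients coincide. *)
Lemma net_frequency_neq0 (mu : 'I_5 -> int) (i : 'I_6) (f : {ffun 'I_5 -> 'I_5}) :
  (forall k, 0 < mu k) -> (forall k, mu k *+ 2 < \sum_j mu j) -> injectiveb f ->
  net_frequency mu i f = 0 -> top_coef b i = top_coef b 2.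
Proof.
move=> mu0 mu2 /injectiveP finj.
have fsum : \sum_(l < 5) mu (f l) = \sum_j mu j.
  by rewrite [RHS](reindex_inj finj).
pose last4 : 'I_5 := lift ord0 (lift ord0 (lift ord0 (lift ord0 ord0))).
have := mu2 (f ord0); have := mu2 (f last4).
have : 0 < \sum_j mu j by apply: le_lt_trans (mu2 ord0); rewrite mulrn_wge0// ltW.
rewrite -fsum /net_frequency /last4.
case: i => -[|[|[|[|[|[|]]]]]] //= _; rewrite !big_ord_recl !big_ord0 /=; lia.
Qed.

End trigonometric_quintic.

(** * A uniform lower bound for the signed sum of integrals *)

Section lacunary_integral.
Variable R : realType.
Local Notation m := (@haar R).

Lemma Rintegral_sum_bounded (I : Type) (s : seq I) (c B : I -> R)
    (F : I -> circle R -> R) :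
  (forall i, measurable_fun setT (F i)) -> (forall i z, `|F i z| <= B i) ->
  \int[m]_z (\sum_(i <- s) c i * F i z) = \sum_(i <- s) c i * \int[m]_z F i z.
Proof.
move=> mF FB.
have iF i : m.-integrable setT (EFin \o F i) by exact: bounded_integrable (mF i) (FB i).
have icF i : m.-integrable setT (EFin \o (fun z => c i * F i z)).
  apply: (@bounded_integrable _ _ (`|c i| * B i)); first exact: measurable_funM.
  by move=> z; rewrite normrM ler_wpM2l.
have bsum s' z : `|\sum_(i <- s') c i * F i z| <= \sum_(i <- s') `|c i| * B i.
  rewrite (le_trans (ler_norm_sum _ _ _))// ler_sum// => i _.
  by rewrite normrM ler_wpM2l.
have isum s' : m.-integrable setT (EFin \o (fun z => \sum_(i <- s') c i * F i z)).
  apply: (bounded_integrable _ (bsum s')).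
  by apply: measurable_sum => i; exact: measurable_funM.
elim: s => [|i s IH].
  under eq_Rintegral do rewrite big_nil.
  by rewrite big_nil Rintegral_cst// mul0r.
under eq_Rintegral do rewrite big_cons.
by rewrite RintegralD// RintegralZl// IH big_cons.
Qed.

Lemma normr_Rintegral_le (F : circle R -> R) (C : R) :
  measurable_fun setT F -> (forall z, `|F z| <= C) -> `|\int[m]_z F z| <= C.
Proof.
move=> mF FC; have iF := bounded_integrable mF FC.
rewrite (le_trans (le_normr_Rintegral _ iF))//.
apply: (@le_trans _ _ (\int[m]_z (C : R))).
  apply: le_Rintegral => //; first exact: integrable_norm.
  apply: (@bounded_integrable _ _ `|C|); first exact: measurable_cst.
  by [].
by rewrite Rintegral_cst//= haar_setT/= mulr1.
Qed.

Variable p : R.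
Hypothesis p1 : 1 <= p.
Local Notation b := (@gbin R (p / 2)).

Lemma lacunaryE (mu : 'I_5 -> int) (r : R) e (z : circle R) :
  lacunary mu r e z = trigpoly (fun k => (-1) ^+ e k * r%:C) mu (index_enum _) z.
Proof. by apply: eq_bigr => k _; rewrite mulrA. Qed.

Lemma normc_sign_mul (r : R) (c : bool) : 0 <= r -> normc ((-1) ^+ c * r%:C) = r.
Proof.
move=> r0; rewrite normcM ger0_normc//.
by case: c; rewrite ?expr0 ?expr1 ?normcN normc1 mul1r.
Qed.

Lemma normc_lacunary (mu : 'I_5 -> int) (r : R) e (z : circle R) : 0 <= r ->
  normc (lacunary mu r e z) <= 5 * r.
Proof.
move=> r0; rewrite lacunaryE (le_trans (normc_trigpoly _ _ _ _))//.
under eq_bigr do rewrite normc_sign_mul//.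
by rewrite sumr_const -[leLHS]mulr_natl card_ord.
Qed.

(** The dominant character has been divided out, which does not change the modulus. *)
Definition modulus_power (mu : 'I_5 -> int) (r : R) e (z : circle R) : R :=
  normc (1 + lacunary mu r e z) `^ p.

Lemma measurable_modulus_power mu r e : measurable_fun setT (modulus_power mu r e).
Proof.
apply: measurable_powR_normc.
apply: (measurable_complexD (f := cst 1) (g := lacunary mu r e)).
  exact: measurable_cst.
rewrite (_ : lacunary mu r e =
  trigpoly (fun k => (-1) ^+ e k * r%:C) mu (index_enum _)).
  exact: measurable_trigpoly.
by apply/funext => z; exact: lacunaryE.
Qed.

Lemma modulus_power_le mu r e z : 0 <= r ->
  `|modulus_power mu r e z| <= (1 + 5 * r) `^ p.
Proof.
move=> r0; apply: (@powR_normc_le _ _ p1 (fun z => 1 + lacunary mu r e z)) => t.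
by rewrite (le_trans (le_normcD _ _))// normc1 lerD2l normc_lacunary.
Qed.

(** [N] counts the pairs of an exponent and a permutation with net frequency 0, all of which have
    the coefficient [top_coef b 2]. The constant [C] does not depend on [mu] or [r]. *)
Lemma signed_sum_integral : exists2 C : R, 0 <= C &
  forall (mu : 'I_5 -> int) (r : R), 0 < r -> r <= 30^-1 ->
    (forall k, 0 < mu k) -> (forall k, mu k *+ 2 < \sum_j mu j) ->
    net_frequency mu 2 [ffun k => k] = 0 ->
  exists2 N : nat, (0 < N)%N &
    `|signed_sum (fun e => \int[m]_z modulus_power mu r e z)
      - 2 ^+ 5 * top_coef b 2 * r ^+ 5 * N%:R| <= C * r ^+ 6.
Proof.
have [C C0 CP] := normc_1D_taylor p.
(* There are 2^5 choices of signs, and the perturbation is at most [5 * r]. *)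
exists (2 ^+ 5 * C * 5 ^+ 6); first by rewrite !mulr_ge0.
move=> mu r r0 r30 mu0 mu2 mu_net.
pose P e z := quintic_part p (2 * complex.Re (lacunary mu r e z))
  (normc (lacunary mu r e z) ^+ 2).
pose a t := (quintic_coef p r t)%:C.
pose d (t : 'I_6 * {ffun 'I_5 -> 'I_5}) := net_frequency mu t.1 t.2.
have PE z : signed_sum (fun e => P e z) = complex.Re (trigpoly a d (index_enum _) z).
  by rewrite -signed_sum_lacunary.
have FP z : `|signed_sum (fun e => modulus_power mu r e z)
    - complex.Re (trigpoly a d (index_enum _) z)| <= 2 ^+ 5 * C * 5 ^+ 6 * r ^+ 6.
  rewrite -PE /signed_sum -sumrB (le_trans (ler_norm_sum _ _ _))//.
  apply: (@le_trans _ _ (\sum_(e : {ffun 'I_5 -> bool}) C * (5 * r) ^+ 6)).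
    apply: ler_sum => e _; rewrite -mulrBr normrM normr_prod.
    rewrite big1 => [|k _]; last by rewrite normrX normrN1 expr1n.
    have w5 := normc_lacunary mu e z (ltW r0).
    (* The bound 1/30 on [r] puts [5 * r] within the radius 1/6 of the expansion. *)
    rewrite mul1r (le_trans (CP _ _))//; first by rewrite (le_trans w5)//; lra.
    rewrite ler_wpM2l//; apply: lerXn2r; rewrite ?nnegrE ?normc_ge0//.
    by rewrite mulr_ge0// ltW.
  rewrite sumr_const card_ffun card_bool card_ord -[leLHS]mulr_natl natrX.
  by rewrite exprMn !mulrA.
have mF := measurable_modulus_power mu r.
have mT : measurable_fun setT (fun z => complex.Re (trigpoly a d (index_enum _) z)).
  by have /measurable_complexP[] := measurable_trigpoly a d (index_enum _).
have bT z : `|complex.Re (trigpoly a d (index_enum _) z)| <=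
    \sum_(t <- index_enum _) normc (a t).
  exact: le_trans (normr_Re_le _) (normc_trigpoly _ _ _ _).
have intF : signed_sum (fun e => \int[m]_z modulus_power mu r e z) =
    \int[m]_z signed_sum (fun e => modulus_power mu r e z).
  rewrite /signed_sum (@Rintegral_sum_bounded _ _ _ (fun=> (1 + 5 * r) `^ p))//.
  by move=> e z; apply: modulus_power_le; exact: ltW.
have mS : measurable_fun setT (fun z => signed_sum (fun e => modulus_power mu r e z)).
  apply: measurable_sum => e; apply: measurable_funM => //.
have bS z : `|signed_sum (fun e => modulus_power mu r e z)| <=
   \sum_(e : {ffun 'I_5 -> bool}) (1 + 5 * r) `^ p.
  rewrite (le_trans (ler_norm_sum _ _ _))// ler_sum// => e _.
  rewrite normrM normr_prod big1 => [|k _]; last by rewrite normrX normrN1 expr1n.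
  by rewrite mul1r modulus_power_le// ltW.
pose zero_net t := (d t == 0) && injectiveb t.2.
exists #|zero_net|.
  (* The given relation between the frequencies is the case of exponent 2 and the identity
     permutation. *)
  apply/card_gt0P; exists (inord 2, [ffun k => k]).
  rewrite unfold_in /zero_net /d /= inordK// mu_net eqxx /=.
  by apply/injectiveP => i j; rewrite !ffunE.
have intT : 2 ^+ 5 * top_coef b 2 * r ^+ 5 * #|zero_net|%:R =
    \int[m]_z complex.Re (trigpoly a d (index_enum _) z).
  rewrite -[RHS]/(complex.Re (cintegral m (trigpoly a d (index_enum _)))).
  rewrite cintegral_trigpoly raddf_sum /= mulr_natr -sumr_const.
  rewrite big_mkcond [RHS]big_mkcond /=; apply: eq_bigr => t _.
  rewrite unfold_in /zero_net /quintic_coef.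
  case: eqP => //= dt0; case: ifP => // tinj.
  by rewrite (net_frequency_neq0 p mu0 mu2 tinj dt0).
rewrite intF intT -RintegralB//; last 2 first.
- exact: bounded_integrable mS bS.
- exact: bounded_integrable mT bT.
by apply: normr_Rintegral_le => //; exact: measurable_funB.
Qed.

Lemma top_coef2E : top_coef b 2 =
  (p / 2 * (p / 2 - 1) / 2) * (p / 2 * (p / 2 - 1) * (p / 2 - 2) / 6).
Proof. by rewrite /top_coef /=; field. Qed.

(** [h] is proportional to p^2 (p - 2)^2 (p - 4). The main term is at least 32 |h| r^5 since N >= 1,
    and the choice of [r] keeps the error below |h| r^5; hence the factor 31 in [delta], which is
    uniform in [mu]. *)
Lemma signed_sum_integral_ge : p <> 2 -> p <> 4 ->
  exists r delta : R, [/\ 0 < r, r <= 30^-1, 0 < delta &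
  forall mu : 'I_5 -> int,
    (forall k, 0 < mu k) -> (forall k, mu k *+ 2 < \sum_j mu j) ->
    net_frequency mu 2 [ffun k => k] = 0 ->
    delta <= `|signed_sum (fun e => \int[m]_z modulus_power mu r e z)|].
Proof.
move=> p2 p4; have [C C0 CP] := signed_sum_integral.
set h := top_coef b 2 in CP.
have h0 : 0 < `|h|.
  rewrite normr_gt0 /h top_coef2E !mulf_neq0 ?invr_eq0 ?pnatr_eq0//;
    by apply/eqP => q; have := p1; (by apply: (p2); lra) || (by apply: (p4); lra) || lra.
pose r := Num.min 30^-1 (`|h| / (C + 1)).
have r0 : 0 < r by rewrite lt_min; apply/andP; split; [lra|apply: divr_gt0; lra].
have Cr : C * r <= `|h|.
  have : r <= `|h| / (C + 1) by rewrite ge_min lexx orbT.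
  by rewrite ler_pdivlMr; nra.
exists r, (31 * `|h| * r ^+ 5); split => //.
- by rewrite ge_min lexx.
- by rewrite !mulr_gt0// exprn_gt0.
move=> mu mu0 mu2 mu_net; have [|N N0] := CP mu r r0 _ mu0 mu2 mu_net.
  by rewrite ge_min lexx.
set D := signed_sum _; set A := _ * N%:R => DA.
have A32 : 32 * `|h| * r ^+ 5 <= `|A|.
  have r5 : 0 <= r ^+ 5 by rewrite exprn_ge0// ltW.
  have -> : A = 32 * h * r ^+ 5 * N%:R by rewrite /A; congr (_ * _ * _ * _); ring.
  rewrite normrM (ger0_norm (ler0n R N)) [`|_ * r ^+ 5|]normrM (ger0_norm r5).
  rewrite [`|32 * h|]normrM (ger0_norm (ler0n R 32)).
  rewrite ler_peMr ?mulr_ge0 ?exprn_ge0 ?(ltW r0) ?(ltW h0)//.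
  by rewrite ler1n.
have : C * r ^+ 6 <= `|h| * r ^+ 5.
  by rewrite [r ^+ 6]exprS mulrA ler_wpM2r// exprn_ge0// ltW.
have := ler_normB D (D - A); rewrite subKr; lra.
Qed.

End lacunary_integral.

(** * Averages of biquadratic characters are small in L^p *)

Section spread_characters.
Variables (R : realType) (p : R) (p1 : 1 <= p).
Local Notation m := (@haar R).

Lemma rnorm_sum_character (E : set int) (I : Type) (s : seq I) (a : I -> R[i])
    (d : I -> int) (dE : forall i, E (d i)) :
  rnorm (\sum_(i <- s) a i *: character p1 (dE i)) =
  (\int[m]_z (normc (trigpoly a d s z) `^ p)) `^ p^-1.
Proof. by rewrite /rnorm norm_sum_character. Qed.

Lemma biquadrates_succ (k : nat) : biquadrates ((k.+1 ^ 4)%N%:Z).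
Proof. by exists k.+1. Qed.

(** Indices start at 0: index [k] has frequency (k + 1)^4, and 81 = 3^4 has index 2. *)
Definition biquadratic_character (k : nat) : LpE p1 biquadrates :=
  character p1 (biquadrates_succ k).

(* Young's inequality bounds y^p <= y by (eta + y^2 / eta) / 2 on [0, 1]. *)
Lemma powR_le_sqr (M x eta : R) : 0 < M -> 0 < eta -> 0 <= x <= M ->
  x `^ p <= M `^ p * (eta / 2) + M `^ p / (2 * eta * M ^+ 2) * x ^+ 2.
Proof.
move=> M0 eta0 /andP[x0 xM]; pose y := x / M.
have y0 : 0 <= y by rewrite divr_ge0// ltW.
have y1 : y <= 1 by rewrite ler_pdivrMr// mul1r.
have xE : x = M * y by rewrite /y mulrCA mulfV ?mulr1// gt_eqF.
rewrite xE powRM// ?(ltW M0)//.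
have yp : y `^ p <= y.
  have [->|yn0] := eqVneq y 0; first by rewrite powR0 ?gt_eqF//; exact: lt_le_trans p1.
  rewrite -[leRHS]powRr1//; apply: ger_powR => //.
  by rewrite lt_neqAle eq_sym yn0 y0.
rewrite [leRHS](_ : _ = M `^ p * ((eta + y ^+ 2 / eta) / 2)); last first.
  by field; rewrite !gt_eqF.
rewrite ler_wpM2l ?powR_ge0// (le_trans yp)//.
rewrite ler_pdivlMr// -(ler_pM2r eta0) mulrDl divfK ?gt_eqF//.
by have := sqr_ge0 (eta - y); nra.
Qed.

(** The p-th power is bounded by a constant plus a multiple of the square, and the square mean is at
    most [M] by orthogonality. This covers every p >= 1. *)
Lemma spread_null_biquadratic_character : spread_null biquadratic_character.
Proof.
move=> e e0; have p0 : 0 < p by exact: lt_le_trans p1.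
(* The p-th root of [M ^ p * eta] is then [e * M]. *)
pose eta := e `^ p; have eta0 : 0 < eta by exact: powR_gt0.
(* With M >= eta^(-2), the square term 1 / (2 eta M) is at most eta / 2. *)
pose M := (Num.bound (eta ^- 2)).+1.
have M0 : 0 < (M%:R : R) by rewrite ltr0n.
have etaM : 1 <= eta ^+ 2 * M%:R.
  have : eta ^- 2 <= M%:R.
    have eta20 : 0 <= eta ^- 2 by rewrite invr_ge0 exprn_ge0// ltW.
    by rewrite (le_trans (ltW (archi_boundP eta20)))// ler_nat leqnSn.
  by rewrite -ler_pdivrMl ?exprn_gt0// mulr1.
exists M => // s th us sM th1.
pose d (k : nat) : int := (k.+1 ^ 4)%N.
pose S := trigpoly th d s.
have mS : measurable_fun setT (fun z => normc (S z)).
  exact/measurable_normc/measurable_trigpoly.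
have SM z : normc (S z) <= M%:R.
  rewrite (le_trans (normc_trigpoly _ _ _ _))// -sM -sum1_size natr_sum.
  by apply: ler_sum => k _; exact: th1.
rewrite rnorm_sum_character.
apply: (@le_trans _ _ ((M%:R `^ p * eta) `^ p^-1)); last first.
  rewrite powRM ?powR_ge0 ?(ltW eta0)// /eta -!powRrM divff ?gt_eqF// !powRr1 ?(ltW M0) ?(ltW e0)//.
  by rewrite mulrC.
apply: ge0_ler_powR; rewrite ?nnegrE ?invr_ge0 ?(ltW p0)//.
- by apply: Rintegral_ge0 => z _; exact: powR_ge0.
- by rewrite mulr_ge0 ?powR_ge0// ltW.
pose A := M%:R `^ p * (eta / 2); pose B := M%:R `^ p / (2 * eta * M%:R ^+ 2).
have B0 : 0 <= B.
  by rewrite /B divr_ge0 ?powR_ge0// !mulr_ge0// ?(ltW eta0)// exprn_ge0.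
have bS2 z : `|normc (S z) ^+ 2| <= M%:R ^+ 2.
  rewrite ger0_norm ?exprn_ge0 ?normc_ge0//.
  by apply: lerXn2r; rewrite ?nnegrE ?normc_ge0.
have mS2 : measurable_fun setT (fun z => normc (S z) ^+ 2) by exact: measurable_funX.
have bBS2 z : `|B * normc (S z) ^+ 2| <= B * M%:R ^+ 2.
  by rewrite normrM ger0_norm// ler_wpM2l.
have iS2 := bounded_integrable mS2 bS2.
have mBS2 : measurable_fun setT (fun z => B * normc (S z) ^+ 2).
  exact: measurable_funM.
have iBS2 := bounded_integrable mBS2 bBS2.
have iA : m.-integrable setT (EFin \o (fun=> A : R)).
  by apply: (@bounded_integrable _ _ `|A|); first exact: measurable_cst.
apply: (@le_trans _ _ (\int[m]_z (A + B * normc (S z) ^+ 2))).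
  apply: le_Rintegral => //.
  - apply: (@bounded_integrable _ _ (M%:R `^ p)).
      exact/measurable_powR_normc/measurable_trigpoly.
    by move=> z; exact: powR_normc_le.
  - apply: (@bounded_integrable _ _ (`|A| + B * M%:R ^+ 2)).
      exact: measurable_funD.
    by move=> z; rewrite (le_trans (ler_normD _ _))// lerD2l.
  - by move=> z _; apply: powR_le_sqr => //; rewrite normc_ge0 SM.
rewrite RintegralD// RintegralZl// Rintegral_cst//= haar_setT /= mulr1.
apply: (@le_trans _ _ (A + B * M%:R)).
  rewrite lerD2l ler_wpM2l// -sM; apply: Rintegral_sqr_trigpoly_le => // i j _ _ /eqP.
  by rewrite /d eqz_nat eqn_exp2r// => /eqP[].
rewrite /A /B [leLHS](_ : _ = M%:R `^ p * (eta / 2 + (2 * eta * M%:R)^-1)); last first.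
  by field; rewrite !gt_eqF.
rewrite ler_wpM2l ?powR_ge0// -lerBrDl (_ : eta - _ = eta / 2); last by field.
rewrite invf_ple ?posrE ?divr_gt0 ?mulr_gt0//.
rewrite -[leLHS]mul1r ler_pdivrMr ?divr_gt0//; nra.
Qed.
End spread_characters.

(** * Ramanujan's biquadratic identity *)

Section ramanujan.

(* Ramanujan: 3^4 + (4n^5+n)^4 + (2n^4-1)^4 = (4n^4+1)^4 + (6n^4-3)^4 + (4n^5-5n)^4.
   The five roots other than 3 are listed, each diminished by 1. *)
Definition ramanujan (n : nat) (i : 'I_5) : nat :=
  nth 0 [:: 4 * n ^ 5 + n - 1; 2 * n ^ 4 - 2; 4 * n ^ 4; 6 * n ^ 4 - 4;
            4 * n ^ 5 - 5 * n - 1]%N i.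

(** Frequencies relative to the dominant 81; positions 0 and 1 lie on its side of the identity. *)
Definition ramanujan_gap (n : nat) (i : 'I_5) : int :=
  ((ramanujan n i).+1 ^ 4)%N%:Z - 81.

(** Ensures that the subtractions of natural numbers in [ramanujan] are not truncated. *)
Lemma exp45_ge n : (2 <= n)%N -> (8 * n <= n ^ 4)%N /\ (16 * n <= n ^ 5)%N.
Proof.
move=> n2; have : (2 ^ 3 <= n ^ 3)%N by rewrite leq_exp2r.
have : (2 ^ 4 <= n ^ 4)%N by rewrite leq_exp2r.
by rewrite !(expnSr n 4) !(expnSr n 3) => ? ?; split; rewrite leq_mul2r; apply/orP; right.
Qed.

(** Shows both that the roots exceed 3 and that they pass any threshold as [n] grows. *)
Lemma ramanujan_ge n i : (2 <= n)%N -> (n.+2 <= ramanujan n i)%N.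
Proof.
move=> n2; have [n4 n5] := exp45_ge n2.
case: i => -[|[|[|[|[|]]]]] //= ?; rewrite /ramanujan /=; lia.
Qed.

Lemma ramanujan_gap_gt0 n i : (2 <= n)%N -> 0 < ramanujan_gap n i.
Proof.
move=> n2; rewrite subr_gt0 (ltz_nat (3 ^ 4) _) ltn_exp2r//.
by have := ramanujan_ge i n2; lia.
Qed.

Lemma ramanujan_gapE n (i : 'I_5) (x : int) : ((ramanujan n i).+1)%:Z = x ->
  ramanujan_gap n i = x ^+ 4 - 81.
Proof. by move=> <-; rewrite /ramanujan_gap -rmorphXn /= natrXE. Qed.

Lemma ramanujan_gap_sum n : (2 <= n)%N ->
  \sum_(l < 5) (if (l < 2)%N then ramanujan_gap n l else - ramanujan_gap n l) = 0.
Proof.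
move=> n2; have [n4 n5] := exp45_ge n2.
have n4Z : (n ^ 4)%N%:Z = n%:Z ^+ 4 by rewrite -rmorphXn /= natrXE.
have n5Z : (n ^ 5)%N%:Z = n%:Z ^+ 5 by rewrite -rmorphXn /= natrXE.
rewrite !big_ord_recl big_ord0 /=.
rewrite (@ramanujan_gapE n _ (4 * n%:Z ^+ 5 + n%:Z)); last first.
  by rewrite /ramanujan /=; lia.
rewrite (@ramanujan_gapE n (lift ord0 ord0) (2 * n%:Z ^+ 4 - 1)); last first.
  by rewrite /ramanujan /=; lia.
rewrite (@ramanujan_gapE n (lift ord0 (lift ord0 ord0)) (4 * n%:Z ^+ 4 + 1)); last first.
  by rewrite /ramanujan /=; lia.
rewrite (@ramanujan_gapE n (lift ord0 (lift ord0 (lift ord0 ord0)))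
    (6 * n%:Z ^+ 4 - 3)); last first.
  by rewrite /ramanujan /=; lia.
rewrite (@ramanujan_gapE n (lift ord0 (lift ord0 (lift ord0 (lift ord0 ord0))))
    (4 * n%:Z ^+ 5 - 5 * n%:Z)); last first.
  by rewrite /ramanujan /=; lia.
by ring.
Qed.

(** Each side of the relation is half of the total and has at least two terms, all positive. *)
Lemma ramanujan_gap_lt n k : (2 <= n)%N ->
  ramanujan_gap n k *+ 2 < \sum_j ramanujan_gap n j.
Proof.
move=> n2; have := ramanujan_gap_sum n2.
have mu0 k' := ramanujan_gap_gt0 k' n2.
rewrite !big_ord_recl !big_ord0 /=.
set i1 : 'I_5 := lift ord0 ord0; set i2 : 'I_5 := lift ord0 (lift ord0 ord0).
set i3 : 'I_5 := lift ord0 (lift ord0 (lift ord0 ord0)).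
set i4 : 'I_5 := lift ord0 (lift ord0 (lift ord0 (lift ord0 ord0))).
have := mu0 ord0; have := mu0 i1; have := mu0 i2; have := mu0 i3; have := mu0 i4.
have [->|[->|[->|[->|->]]]] : k = ord0 \/ k = i1 \/ k = i2 \/ k = i3 \/ k = i4.
  case: k => -[|[|[|[|[|]]]]] // ?; [left|right; left|right; right; left
    |right; right; right; left|do 4!right]; exact: val_inj.
all: lia.
Qed.

End ramanujan.

(** * The effect of a sign flip on the integrals *)

Section sign_flip.
Variable R : realType.
Local Notation m := (@haar R).
Variables (p : R) (p1 : 1 <= p).

Definition flip_signs n (e : {ffun 'I_n -> bool}) : {ffun 'I_n -> bool} :=
  [ffun k => ~~ e k].

(** Every sign in the weight changes. For [n = 5] the factor is -1, so the signed sum depends only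
    on differences between opposite sign choices. *)
Lemma signed_sum_flip (K : comNzRingType) n (F : {ffun 'I_n -> bool} -> K) :
  signed_sum (fun e => F (flip_signs e)) = (-1) ^+ n * signed_sum F.
Proof.
have flipK : involutive (@flip_signs n).
  by move=> e; apply/ffunP => k; rewrite !ffunE negbK.
rewrite [in RHS]/signed_sum (reindex_inj (inv_inj flipK)) mulr_sumr.
apply: eq_bigr => e _; rewrite mulrA; congr (_ * _).
rewrite -[X in (-1) ^+ X](card_ord n) -prodrN.
by apply: eq_bigr => k _; rewrite ffunE; case: (e k); rewrite ?opprK.
Qed.

Lemma modulus_power_integral_ge (mu : 'I_5 -> int) (r : R) e : 0 <= r -> r <= 30^-1 ->
  2^-1 `^ p <= \int[m]_z modulus_power p mu r e z.
Proof.
move=> r0 r30; rewrite -[leLHS]mulr1 -[X in _ * X](_ : fine (m setT) = 1); last first.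
  by rewrite haar_setT.
rewrite -Rintegral_cst//; apply: le_Rintegral => //.
- by apply: (@bounded_integrable _ _ `|2^-1 `^ p|); first exact: measurable_cst.
- apply: bounded_integrable; first exact: measurable_modulus_power.
  by move=> z; exact: modulus_power_le.
move=> z _; apply: ge0_ler_powR; rewrite ?nnegrE ?normc_ge0//.
  exact: le_trans p1.
have := le_normcD (1 + lacunary mu r e z) (- lacunary mu r e z).
rewrite addrK normc1 normcN; have := normc_lacunary mu e z r0; lra.
Qed.

(** Passes from p-th roots to the integrals. As the root of [v] is at least 1/2, the additive [c] is
    absorbed in a factor [1 + 3 * c], whose p-th power exceeds 1 by at most [3 * C * c]. *)
Lemma powR_root_step (C B c u v : R) : 0 <= C -> 0 <= c -> c <= 6^-1 ->
  (forall s : R, `|s| <= 2^-1 -> `|(1 + s) `^ p - binomial_sum p 1 s| <= C * `|s| ^+ 1) ->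
  0 <= u -> 0 <= v <= B -> 2^-1 `^ p <= v ->
  u `^ p^-1 <= (1 + c) * v `^ p^-1 + c -> u - v <= 3 * C * B * c.
Proof.
move=> C0 c0 c6 CP u0 /andP[v0 vB] v2; have p0 : 0 < p by exact: lt_le_trans p1.
have root (t : R) : 0 <= t -> (t `^ p^-1) `^ p = t.
  by move=> t0; rewrite -powRrM mulVf ?gt_eqF// powRr1.
have Y2 : 2^-1 <= v `^ p^-1.
  have half : 2^-1 = (2^-1 `^ p) `^ p^-1 :> R.
    by rewrite -powRrM mulfV ?gt_eqF// powRr1//; lra.
  rewrite [leLHS]half; apply: ge0_ler_powR => //.
  - by rewrite invr_ge0 ltW.
  - by rewrite nnegrE powR_ge0.
move=> XY; have XY3 : u `^ p^-1 <= (1 + 3 * c) * v `^ p^-1 by nra.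
have uv : u <= (1 + 3 * c) `^ p * v.
  rewrite -{1}(root u u0) -{1}(root v v0) -powRM; [|by lra|by lra].
  by apply: ge0_ler_powR; rewrite ?nnegrE ?powR_ge0 ?mulr_ge0 ?(ltW p0)//; lra.
have c3 : `|3 * c| <= 2^-1 by rewrite ger0_norm; lra.
have := le_trans (ler_norm _) (CP _ c3).
rewrite /binomial_sum big_ord1 /= expr0 mulr1 expr1 (ger0_norm (_ : 0 <= 3 * c)); last by lra.
move=> h; have : ((1 + 3 * c) `^ p - 1) * v <= C * (3 * c) * B.
  by rewrite (le_trans (ler_wpM2r v0 h))// ler_wpM2l// mulr_ge0//; lra.
lra.
Qed.

(** Factoring out z^81, of modulus 1, shifts the other frequencies by 81. *)
Lemma rnorm_dominant_sum (n : nat) (r : R) (e : {ffun 'I_5 -> bool}) :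
  rnorm (biquadratic_character p1 2 + \sum_(i < 5)
    ((-1) ^+ e i * r%:C) *: biquadratic_character p1 (ramanujan n i)) =
  (\int[m]_z modulus_power p (ramanujan_gap n) r e z) `^ p^-1.
Proof.
(* None carries the dominant frequency 81 = 3^4. *)
pose kk (i : option 'I_5) := if i is Some j then ramanujan n j else 2%N.
pose a (i : option 'I_5) : R[i] := if i is Some j then (-1) ^+ e j * r%:C else 1.
pose s := None :: [seq Some j | j <- index_enum 'I_5].
transitivity (rnorm (\sum_(i <- s) a i *: character p1 (biquadrates_succ (kk i)))).
  by rewrite big_cons big_map /= scale1r.
rewrite rnorm_sum_character; apply: (congr1 (fun t => t `^ p^-1)).
apply: eq_Rintegral => z _; apply: (congr1 (fun t => t `^ p)).
rewrite /trigpoly big_cons big_map mul1r lacunaryE /=.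
rewrite [in LHS](_ : \sum_(_ <- _) _ = (z : R[i]) ^ 81%N *
   trigpoly (fun k => (-1) ^+ e k * r%:C) (ramanujan_gap n) (index_enum _) z).
  by rewrite -[X in X + _]mulr1 -mulrDr normcM normc_circleX mul1r.
rewrite /trigpoly mulr_sumr; apply: eq_bigr => k _.
by rewrite /ramanujan_gap mulrCA -expfzDr ?circle_neq0// addrC subrK.
Qed.

End sign_flip.

(** * Contradiction between the two bounds on the signed sum *)

Theorem proposition1p3p5 (R : realType) (p : R) (p1 : 1 <= p) :
  real_umap (LpE p1 biquadrates) -> p = 2 \/ p = 4.
Proof.
move=> umapE; have [p2|p2] := eqVneq p 2; first by left.
have [p4|p4] := eqVneq p 4; first by right.
exfalso.
have [r [delta [r0 r30 delta0 lower]]] :=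
  signed_sum_integral_ge p1 (elimN eqP p2) (elimN eqP p4).
have p0 : 0 < p by exact: (lt_le_trans ltr01 p1).
have [C C0 CP] := binomial_taylor 1 p.
pose I n (e : {ffun 'I_5 -> bool}) := \int[@haar R]_z modulus_power p (ramanujan_gap n) r e z.
pose B := (1 + 5 * r) `^ p; have B0 : 0 <= B by exact: powR_ge0.
(* Makes 32 differences of size [3 * C * B * c] smaller than [delta]; the bound 1/6 is required by
   [powR_root_step]. *)
pose c := Num.min (delta / (64 * (3 * C * B + 1))) 6^-1.
have CB0 : 0 <= C * B by rewrite mulr_ge0.
have c0 : 0 < c by rewrite lt_min divr_gt0 ?mulr_gt0//; lra.
have cCB : 32 * (3 * C * B * c) < delta.
  have : c <= delta / (64 * (3 * C * B + 1)) by rewrite ge_min lexx.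
  by rewrite ler_pdivlMr; nra.
have c6 : c <= 6^-1 by rewrite ge_min lexx orbT.
have [N NP] := umap_flip (biquadratic_character p1 2) 5 umapE
  (spread_null_biquadratic_character p1) c0.
(* [N] makes the characters far enough for the flip, 2 makes Ramanujan's roots admissible. *)
pose n := maxn N 2; have n2 : (2 <= n)%N by rewrite leq_maxr.
have IB (e : {ffun 'I_5 -> bool}) : 0 <= I n e <= B.
  rewrite Rintegral_ge0 => [|z _]; last exact: powR_ge0.
  rewrite (le_trans (ler_norm _))//; apply: normr_Rintegral_le.
    exact: measurable_modulus_power.
  by move=> z; apply: modulus_power_le => //; exact: ltW.
have step (e : {ffun 'I_5 -> bool}) : I n (flip_signs e) - I n e <= 3 * C * B * c.
  have /= := NP (fun i => (-1) ^+ e i * r%:C) (ramanujan n).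
  have -> : biquadratic_character p1 2 - \sum_(i < 5)
      ((-1) ^+ e i * r%:C) *: biquadratic_character p1 (ramanujan n i) =
    biquadratic_character p1 2 + \sum_(i < 5)
      ((-1) ^+ flip_signs e i * r%:C) *: biquadratic_character p1 (ramanujan n i).
    rewrite -sumrN; congr (_ + _); apply: eq_bigr => i _.
    by rewrite -scaleNr -mulNr ffunE; case: (e i); rewrite ?opprK.
  rewrite !rnorm_dominant_sum.
  move=> XY; apply: (powR_root_step p1 C0 (ltW c0) c6 CP).
  - by case/andP: (IB (flip_signs e)).
  - by case/andP: (IB e).
  - by apply: modulus_power_integral_ge => //; exact: ltW.
  apply: XY => i; first by rewrite normc_sign_mul ?(ltW r0)//; lra.
  rewrite (leq_trans (leq_maxl N 2))// (leq_trans _ (ramanujan_ge i n2))//.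
  exact: leq_trans (leqnSn _) (leqnSn _).
have lowerI : delta <= `|signed_sum (I n)|.
  apply: lower => [k|k|]; first exact: ramanujan_gap_gt0.
    exact: ramanujan_gap_lt.
  rewrite /net_frequency; under eq_bigr do rewrite ffunE.
  exact: ramanujan_gap_sum.
move: step lowerI; move: (I n) => J step; rewrite leNgt => /negP; apply.
have flipK (e : {ffun 'I_5 -> bool}) : flip_signs (flip_signs e) = e.
  by apply/ffunP => k; rewrite !ffunE negbK.
(* The flip inequality is one-sided; applied to [e] and to its flip it bounds the absolute value. *)
have stepN (e : {ffun 'I_5 -> bool}) : `|J e - J (flip_signs e)| <= 3 * C * B * c.
  rewrite ler_norml; have := step e; have := step (flip_signs e); rewrite flipK.
  by move=> h1 h2; apply/andP; split; lra.
(* An odd number of signs makes the signed sum odd under the flip, so twice it is a signed sum of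
   small differences. *)
have D2 : 2 * signed_sum (J) = signed_sum (fun e => J e - J (flip_signs e)).
  have -> : signed_sum (fun e => J e - J (flip_signs e)) =
      signed_sum (J) + (-1) * signed_sum (fun e => J (flip_signs e)).
    by rewrite -signed_sumZ -signed_sumD; apply: eq_signed_sum => e; rewrite mulN1r.
  by rewrite signed_sum_flip; ring.
have : `|2 * signed_sum (J)| <= 32 * (3 * C * B * c).
  rewrite D2 (le_trans (ler_norm_sum _ _ _))//.
  apply: (@le_trans _ _ (\sum_(e : {ffun 'I_5 -> bool}) (3 * C * B * c))).
    apply: ler_sum => e _; rewrite normrM normr_prod big1 ?mul1r//.
    by move=> k _; rewrite normrX normrN1 expr1n.
  rewrite sumr_const card_ffun card_bool card_ord -[leLHS]mulr_natl.
  exact: lexx.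
rewrite normrM (ger0_norm (ler0n R 2)).
by have := normr_ge0 (signed_sum (J)); lra.
Qed.
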